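(* Let $\mathcal{A}$ be the disc algebra. Then every element of $\mathrm{GL}_2(\mathcal{A})$ is a product of two exponentials, i.e. for every $A\in \mathrm{GL}_2(\mathcal{A})$ there exist $2\times2$ matrices $B,C$ with entries in $\mathcal{A}$ such that $A=\exp(B)\exp(C)$.
   Context: The disc algebra $\mathcal{A}$ is the $\mathbb{C}$-Banach algebra of continuous functions $\{z\in\mathbb{C}: |z|\le 1\}\to\mathbb{C}$ that are holomorphic on the interior $\{|z|<1\}$, with pointwise operations and the supremum norm. $\mathrm{GL}_2(\mathcal{A})$ is the group of invertible $2\times2$ matrices with entries in $\mathcal{A}$. The exponential of a matrix $B$ with entries in $\mathcal{A}$ is $\exp(B)=\sum_{n\ge 0} B^n/n!$, equivalently the pointwise matrix exponential $z\mapsto \exp(B(z))$. *)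

(* Defs.v *)
From HB Require Import structures.
From mathcomp Require Import all_boot all_order all_algebra.
From mathcomp Require Import all_classical all_reals all_analysis.
From mathcomp Require Import complex.

Set Implicit Arguments.
Unset Strict Implicit.
Unset Printing Implicit Defensive.

Import Order.TTheory GRing.Theory Num.Theory.
Import numFieldNormedType.Exports.

Local Open Scope classical_set_scope.
Local Open Scope ring_scope.

(* Naming R[i] as a numClosedFieldType gives its carrier the norm topology of
   a numFieldType, which the bare type R[i] does not have. *)
Definition Cplx (R : realType) : numClosedFieldType := R[i].

Definition closed_disc (R : realType) : set (Cplx R) := [set z | `|z| <= 1].
Arguments closed_disc : clear implicits.

(* A set coerces to a type, which carries the subspace topology. *)
Definition cdisc (R : realType) : Type := closed_disc R.

HB.instance Definition _ (R : realType) := Choice.on (cdisc R).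
HB.instance Definition _ (R : realType) := Uniform.on (cdisc R).

Lemma closed_disc0 (R : realType) : (0 : Cplx R) \in closed_disc R.
Proof. by rewrite inE /closed_disc /= normr0 ler01. Qed.

HB.instance Definition _ (R : realType) :=
  isPointed.Build (cdisc R) (SigSub (closed_disc0 R)).

(* 'valL_0 extends f by 0 outside of the closed disc; complex derivability at
   an interior point depends only on the values of f near that point. *)
Definition disc_alg_fun (R : realType) (f : cdisc R -> Cplx R) : Prop :=
  continuous f /\
  forall z : Cplx R, `|z| < 1 ->
    derivable ('valL_0 (f : closed_disc R -> Cplx R)) z 1.

Definition disc_alg_pred (R : realType) : {pred cdisc R -> Cplx R} :=
  mem (@disc_alg_fun R : set _).

Record disc_alg (R : realType) : Type := DiscAlg {
  disc_alg_val :> cdisc R -> Cplx R;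
  _ : disc_alg_val \in @disc_alg_pred R }.

HB.instance Definition _ (R : realType) := [isSub for @disc_alg_val R].
HB.instance Definition _ (R : realType) := [Choice of disc_alg R by <:].

Section DiscAlgebra.
Variable R : realType.
Local Notation C := (Cplx R).
Local Notation D := (closed_disc R).
Local Notation ext f := ('valL_0 (f : D -> C) : C -> C).

Lemma extE (f : cdisc R -> C) (z : C) (zD : z \in D) :
  ext f z = f (SigSub zD).
Proof. by rewrite /valL_ oinv_set_val/= insubT. Qed.

Lemma ext_out (f : cdisc R -> C) (z : C) : z \notin D -> ext f z = 0.
Proof. by move=> zD; rewrite /valL_ oinv_set_val/= insubN. Qed.

Lemma near_closed_disc (z : C) : `|z| < 1 -> \forall w \near z, w \in D.
Proof.
move=> z1; have z1' : 0 < 1 - `|z| by rewrite subr_gt0.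
apply: filterS (near_ball z _ z1') => w; rewrite -ball_normE /= distrC => zw.
rewrite inE /closed_disc /= -[w](subrK z); apply: le_trans (ler_normD _ _) _.
by rewrite -lerBrDr ltW.
Qed.

Lemma ext_cst (c z : C) : `|z| < 1 -> derivable (ext (cst c)) z 1.
Proof.
move=> z1; apply: (near_eq_derivable _ (derivable_cst c z 1)).
by apply: filterS (near_closed_disc z1) => w wD; rewrite (extE _ wD).
Qed.

Lemma extD (f g : cdisc R -> C) : ext (f + g) = ext f + ext g.
Proof.
apply/funext => z; change (ext (f + g) z = ext f z + ext g z); have [zD|zD] := boolP (z \in D).
  by rewrite !extE.
by rewrite !ext_out // addr0.
Qed.

Lemma extM (f g : cdisc R -> C) : ext (f * g) = ext f * ext g.
Proof.
apply/funext => z; change (ext (f * g) z = ext f z * ext g z); have [zD|zD] := boolP (z \in D).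
  by rewrite !extE.
by rewrite !ext_out // mulr0.
Qed.

Lemma extZ (a : C) (f : cdisc R -> C) : ext (a *: f) = a *: ext f.
Proof.
apply/funext => z; change (ext (a *: f) z = a *: ext f z); have [zD|zD] := boolP (z \in D).
  by rewrite !extE.
by rewrite !ext_out // scaler0.
Qed.

Lemma disc_alg_cst (c : C) : cst c \in @disc_alg_pred R.
Proof. by apply/mem_set; split; [exact: cst_continuous|exact: ext_cst]. Qed.

Lemma disc_algD f g : f \in @disc_alg_pred R -> g \in @disc_alg_pred R ->
  f + g \in @disc_alg_pred R.
Proof.
move=> /set_mem[cf df] /set_mem[cg dg]; apply/mem_set; split => [z|z z1].
  exact: (continuousD (cf z) (cg z)).
by rewrite extD; apply: derivableD; [exact: df|exact: dg].
Qed.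

Lemma disc_algM f g : f \in @disc_alg_pred R -> g \in @disc_alg_pred R ->
  f * g \in @disc_alg_pred R.
Proof.
move=> /set_mem[cf df] /set_mem[cg dg]; apply/mem_set; split => [z|z z1].
  exact: (continuousM (cf z) (cg z)).
by rewrite extM; apply: derivableM; [exact: df|exact: dg].
Qed.

Lemma disc_algZ a f : f \in @disc_alg_pred R -> a *: f \in @disc_alg_pred R.
Proof.
move=> /set_mem[cf df]; apply/mem_set; split => [z|z z1].
  exact: (continuousZl_tmp (cf z)).
by rewrite extZ; apply: derivableZ; exact: df.
Qed.

Lemma disc_alg_subring_closed : subring_closed (@disc_alg_pred R).
Proof.
split => [|f g fA gA|]; [exact: disc_alg_cst| |exact: disc_algM].
have -> : f - g = f + (-1 : C) *: g by rewrite scaleN1r.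
exact: (disc_algD fA (disc_algZ (-1) gA)).
Qed.
HB.instance Definition _ :=
  GRing.isSubringClosed.Build _ (@disc_alg_pred R) disc_alg_subring_closed.

HB.instance Definition _ :=
  GRing.isScaleClosed.Build C _ (@disc_alg_pred R) disc_algZ.

HB.instance Definition _ := [SubChoice_isSubComNzRing of disc_alg R by <:].
HB.instance Definition _ := [SubZmodule_isSubLmodule of disc_alg R by <:].

Lemma disc_alg_scalerAl (a : C) (f g : disc_alg R) :
  a *: (f * g) = (a *: f) * g.
Proof. by apply: val_inj; apply/funext => z /=; rewrite !fctE; exact: mulrA. Qed.
HB.instance Definition _ :=
  GRing.Lmodule_isLalgebra.Build C (disc_alg R) disc_alg_scalerAl.
HB.instance Definition _ :=
  GRing.Lalgebra_isComAlgebra.Build C (disc_alg R).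

Definition disc_alg_unit : {pred disc_alg R} :=
  mem [set f : disc_alg R | exists g, g * f = 1].

Definition disc_alg_inv (f : disc_alg R) : disc_alg R :=
  if pselect (exists g, g * f = 1) is left fU then projT1 (cid fU) else f.

Lemma disc_alg_mulVx : {in disc_alg_unit, left_inverse 1 disc_alg_inv *%R}.
Proof.
move=> f /set_mem fU; rewrite /disc_alg_inv.
by case: pselect => // ?; case: cid.
Qed.

Lemma disc_alg_unitPl (f g : disc_alg R) : g * f = 1 -> disc_alg_unit f.
Proof. by move=> gf1; apply/mem_set; exists g. Qed.

Lemma disc_alg_invr_out : {in [predC disc_alg_unit], disc_alg_inv =1 id}.
Proof.
move=> f; rewrite inE /= => /negP fU; rewrite /disc_alg_inv.
by case: pselect => // ?; case: fU; apply/mem_set.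
Qed.

HB.instance Definition _ := GRing.ComNzRing_hasMulInverse.Build (disc_alg R)
  disc_alg_mulVx disc_alg_unitPl disc_alg_invr_out.

(* The modulus of z as a real number: `|z| itself has type C. *)
Definition modulus (z : C) : R := complex.Re `|z|.

Lemma modulusE (z : C) : `|z| = (modulus z)%:C%C :> C.
Proof. by rewrite /modulus /Cplx normc_def. Qed.

Lemma modulus_ge0 (z : C) : 0 <= modulus z.
Proof. by rewrite /modulus /Cplx normc_def /= sqrtr_ge0. Qed.

Lemma modulusD (z w : C) : modulus (z + w) <= modulus z + modulus w.
Proof. exact: (@le_normcD R z w). Qed.

Lemma modulusM (z w : C) : modulus (z * w) = modulus z * modulus w.
Proof. by apply/complexI; rewrite rmorphM /= -!modulusE normrM. Qed.

Lemma ltr_modulus (z : C) (e : R) : (`|z| < e%:C%C :> C) = (modulus z < e).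
Proof. by rewrite modulusE; exact: ltcR. Qed.

Lemma ler_modulus (z : C) (e : R) : (`|z| <= e%:C%C :> C) = (modulus z <= e).
Proof. by rewrite modulusE; exact: lecR. Qed.

Lemma ler_modulus1 (z : C) : (`|z| <= 1) = (modulus z <= 1).
Proof. exact: ler_modulus z 1. Qed.

Lemma continuous_modulus : continuous modulus.
Proof.
move=> z; apply/(@cvgrPdist_lt _ _ _ (nbhs z)) => e e0; apply/nbhs_ballP.
exists (e%:C%C : C) => [|w]; first by rewrite /= /Cplx ltcR.
rewrite -ball_normE /= ltr_modulus; apply: le_lt_trans.
have dist x y : modulus x <= modulus y + modulus (x - y).
  by apply: le_trans (modulusD _ _); rewrite addrC subrK.
rewrite ler_norml lerNl opprB !lerBlDl dist andbT.
by have -> : modulus (z - w) = modulus (w - z) by rewrite /modulus distrC.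
Qed.

Lemma compact_closed_disc : compact D.
Proof.
pose h (p : R * R) : C := Complex p.1 p.2.
have hc : continuous h.
  move=> p; apply/(@cvgrPdist_lt _ _ _ (nbhs p)) => e e0.
  have e0' : 0 < complex.Re e by move: e0; rewrite /Cplx ltcE => /andP[].
  have eE : e = (complex.Re e)%:C%C :> C.
    by move: (ger0_Im (ltW e0)) => {e0 e0'}; case: e => a b /= ->.
  have ph : 0 < complex.Re e / 2 by rewrite divr_gt0.
  exists (ball p.1 (complex.Re e / 2), ball p.2 (complex.Re e / 2)).
    by split; apply: nbhsx_ballx.
  case=> x y [/= px py]; rewrite eE ltr_modulus.
  move: px py; rewrite -!ball_normE /= => px py.
  have -> : h p - h (x, y) =
      (p.1 - x)%:C%C + Complex 0 (p.2 - y) :> C.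
    by rewrite /h; apply/eqP; rewrite eq_complex /= addr0 add0r !eqxx.
  apply: le_lt_trans (modulusD _ _) _; rewrite [ltRHS]splitr.
  by rewrite ltrD // /modulus /Cplx normc_def /= !expr0n /= ?addr0 ?add0r sqrtr_sqr.
apply: (@subclosed_compact _ _ (h @` (`[-1, 1] `*` `[-1, 1]))).
- rewrite (_ : D = modulus @^-1` [set x | x <= 1]).
    by apply: closed_comp; [move=> z _; exact: continuous_modulus|exact: closed_le].
  by apply/seteqP; split => z; rewrite /closed_disc /= ler_modulus1.
- apply: continuous_compact.
    by apply: continuous_subspaceT.
  by apply: compact_setX; exact: segment_compact.
- move=> z; rewrite /closed_disc /= => z1; exists (complex.Re z, complex.Im z).
    have : modulus z <= 1 by rewrite -ler_modulus1.
    rewrite /modulus /Cplx normc_def /= => z1'.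
    have := sqrtr_ge0 (complex.Re z ^+ 2 + complex.Im z ^+ 2).
    rewrite /= !in_itv /= -!ler_norml.
    by split; rewrite -sqrtr_sqr; apply: le_trans z1'; apply: ler_wsqrtr;
      rewrite ?lerDl ?lerDr sqr_ge0.
  by rewrite /h; case: (z).
Qed.

Definition moduli (f : disc_alg R) : set R := range (fun z => modulus (f z)).

Lemma has_sup_moduli (f : disc_alg R) : has_sup (moduli f).
Proof.
split; first by exists (modulus (f point)), point.
have [fc _] := set_mem (valP f).
have fD : {within D, continuous (ext f)} by apply/subspace_valL_continuousP'.
have : compact (modulus @` (ext f @` D)).
  apply: continuous_compact.
    by apply: continuous_subspaceT; exact: continuous_modulus.
  exact: continuous_compact fD compact_closed_disc.
move=> /compact_bounded[M [_ /(_ (M + 1))]]; rewrite ltrDl ltr01 => /(_ isT) fM.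
exists (M + 1) => _ [z _ <-]; apply: le_trans (ler_norm _) _; apply: fM => /=.
exists (f z) => //; case: z => z zD; exists z; first exact: set_mem.
exact: (extE f zD).
Qed.

Definition sup_norm (f : disc_alg R) : C := (sup (moduli f))%:C%C.

Lemma sup_norm_ub (f : disc_alg R) z : modulus (f z) <= sup (moduli f).
Proof. by apply: ub_le_sup; [case: (has_sup_moduli f)|exists z]. Qed.

Lemma sup_norm_le (f : disc_alg R) (M : R) :
  (forall z, modulus (f z) <= M) -> sup (moduli f) <= M.
Proof.
move=> fM; apply: ge_sup => [|_ [z _ <-]] //.
by case: (has_sup_moduli f).
Qed.

Lemma sup_normD (f g : disc_alg R) : sup_norm (f + g) <= sup_norm f + sup_norm g.
Proof.
rewrite /sup_norm -rmorphD /= /Cplx lecR; apply: sup_norm_le => z.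
by apply: le_trans (modulusD _ _) _; rewrite lerD ?sup_norm_ub.
Qed.

Lemma sup_normZ_le (a : C) (f : disc_alg R) :
  sup (moduli (a *: f)) <= modulus a * sup (moduli f).
Proof.
apply: sup_norm_le => z.
by rewrite [leLHS]modulusM ler_wpM2l ?modulus_ge0 ?sup_norm_ub.
Qed.

Lemma sup_normZ (a : C) (f : disc_alg R) : sup_norm (a *: f) = `|a| * sup_norm f.
Proof.
rewrite /sup_norm modulusE -rmorphM /=; congr (_%:C)%C.
apply/eqP; rewrite eq_le sup_normZ_le /=.
have [->|a0] := eqVneq a 0.
  have -> : modulus 0 = 0 by rewrite /modulus normr0.
  rewrite mul0r; apply: le_trans (sup_norm_ub _ point).
  exact: modulus_ge0.
have ma0 : 0 < modulus a.
  by rewrite lt_def modulus_ge0 andbT; apply: contra a0 => /eqP ma;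
    rewrite -normr_eq0 modulusE ma.
have maV : modulus a^-1 = (modulus a)^-1.
  have ma0' := lt0r_neq0 ma0; apply: (mulfI ma0').
  by rewrite -modulusM (divff a0) (divff ma0') /modulus normr1.
have := sup_normZ_le a^-1 (a *: f).
by rewrite scalerA mulVf // scale1r maV ler_pdivlMl.
Qed.

Lemma sup_norm_eq0 (f : disc_alg R) : sup_norm f = 0 -> f = 0.
Proof.
case=> f0; apply/val_inj/funext => z /=; apply/eqP; rewrite -normr_eq0 modulusE.
have : modulus (f z) <= 0 by rewrite -f0 sup_norm_ub.
by move=> h; rewrite (_ : modulus _ = 0) //; apply/le_anti; rewrite h modulus_ge0.
Qed.

HB.instance Definition _ := Lmodule_isNormed.Build C (disc_alg R)
  sup_normD sup_normZ sup_norm_eq0.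

End DiscAlgebra.

(* The limit is taken in the topology of entrywise convergence for sup_norm;
   the coefficient 1/k! is a constant of C embedded in the algebra. *)
Definition mexp (R : realType) (n : nat) (B : 'M[disc_alg R]_n.+1) :
    'M[disc_alg R]_n.+1 :=
  limn (series (fun k => ((k`!%:R^-1 : Cplx R)%:A : disc_alg R) *: B ^+ k)).

(* Main.v *)
Require Import Defs.
From HB Require Import structures.
From mathcomp Require Import all_boot all_order all_algebra.
From mathcomp Require Import all_classical all_reals all_analysis.
From mathcomp Require Import complex.
From mathcomp Require Import ring lra.

(** Write [A = mx2 a b c d].  Conjugating [A] by an elementary matrix replaces
    the corner [a] by [a + x * b], and [a], [b] generate the unit ideal because
    [a * d - b * c] is a unit.  If the new corner is a unit for some [x], then
    the conjugate is a product of a lower and an upper triangular matrix.  The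
    diagonals of these two factors can be rescaled so that within each factor
    the difference of the diagonal entries is a unit ([mx2_conj_lu]); the
    factors are then diagonalizable over the disc algebra, with unit
    eigenvalues.  Since the disc is simply connected, units have logarithms
    ([disc_alg_log]), and a diagonalizable matrix whose eigenvalues have
    logarithms is an exponential ([mexp_diag]).

    The heart of the matter is that [x] exists, that is, that the disc algebra
    has stable rank one ([disc_alg_stable_rank]).  Call [f] reducible modulo
    [g] if some [f + x * g] is a unit.  Reducibility is multiplicative in [f],
    and both an open and a closed condition among the [f] without common zero
    with [g] ([reducible_near], [reducible_close]).  As polynomials are dense,
    it suffices to reduce [z - a] for [g a] nonzero ([reducible_dlin]).  For
    [a] outside the closed disc this is a unit, and [a] can be moved out of the
    disc along points where [g] does not vanish: by the maximum principle the
    zeros of [g] do not separate the plane.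

    Density of polynomials ([disc_alg_poly_approx]) rests on Cauchy's formula
    for functions that are merely complex differentiable at each point.  It is
    obtained from Goursat's bisection ([goursat]) on rectangles: in
    the coordinate [w] with [z = cexp w] an annulus is a rectangle, so the mean
    of a holomorphic function over a circle does not depend on the radius
    ([mean_annulus]); applied to a difference quotient, this is Cauchy's
    formula ([cauchy_formula]), and expanding its kernel into a geometric sum
    gives polynomials ([holomorphic_poly_approx]). *)

Set Implicit Arguments.
Unset Strict Implicit.
Unset Printing Implicit Defensive.

Import Order.TTheory GRing.Theory Num.Theory.
Import numFieldNormedType.Exports.

Local Open Scope classical_set_scope.
Local Open Scope ring_scope.

(** * The complex plane with real radii *)

Section ComplexPlane.
Variable R : realType.
Local Notation C := (Cplx R).
Implicit Types (z w : C) (x y : R).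

Lemma modulusR x : modulus (x%:C%C : C) = `|x|.
Proof. by rewrite /modulus /Cplx normc_def /= expr0n /= addr0 sqrtr_sqr. Qed.

Lemma modulus0 : modulus (0 : C) = 0.
Proof. by rewrite /modulus normr0. Qed.

Lemma modulus1 : modulus (1 : C) = 1.
Proof. by rewrite /modulus normr1. Qed.

Lemma modulusN z : modulus (- z) = modulus z.
Proof. by rewrite /modulus normrN. Qed.

Lemma modulusB z w : modulus (z - w) <= modulus z + modulus w.
Proof. by rewrite -(modulusN w); exact: modulusD. Qed.

Lemma modulus_distC z w : modulus (z - w) = modulus (w - z).
Proof. by rewrite -opprB modulusN. Qed.

Lemma modulusBB z w v : modulus (z - v) <= modulus (z - w) + modulus (w - v).
Proof. by rewrite -[z - v](subrKA w) modulusD. Qed.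

Lemma modulus_eq0 z : (modulus z == 0) = (z == 0).
Proof.
apply/eqP/eqP => [mz|->]; last exact: modulus0.
by apply/eqP; rewrite -normr_eq0 modulusE mz.
Qed.

Lemma modulus_gt0 z : (0 < modulus z) = (z != 0).
Proof. by rewrite lt_def modulus_ge0 andbT modulus_eq0. Qed.

Lemma modulusX z n : modulus (z ^+ n) = modulus z ^+ n.
Proof.
elim: n => [|n IH]; first by rewrite !expr0 modulus1.
by rewrite !exprS modulusM IH.
Qed.

Lemma modulusV z : modulus z^-1 = (modulus z)^-1.
Proof.
have [->|z0] := eqVneq z 0; first by rewrite invr0 modulus0 invr0.
have mz0 : modulus z != 0 by rewrite modulus_eq0.
by apply: (mulfI mz0); rewrite -modulusM !divff ?modulus1.
Qed.

Lemma modulusi : modulus ('i%C : C) = 1.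
Proof. by rewrite /modulus /Cplx normc_def /= expr0n /= add0r expr1n sqrtr1. Qed.

Lemma Re_le_modulus z : `|complex.Re z| <= modulus z.
Proof.
by rewrite /modulus /Cplx normc_def /= -sqrtr_sqr ler_wsqrtr// lerDl sqr_ge0.
Qed.

Lemma Im_le_modulus z : `|complex.Im z| <= modulus z.
Proof.
by rewrite /modulus /Cplx normc_def /= -sqrtr_sqr ler_wsqrtr// lerDr sqr_ge0.
Qed.

Lemma modulus_le_ReIm z : modulus z <= `|complex.Re z| + `|complex.Im z|.
Proof.
rewrite {1}(_ : z = (complex.Re z)%:C%C + 'i%C * (complex.Im z)%:C%C); last first.
  exact: complexE.
by rewrite (le_trans (modulusD _ _))// modulusM modulusi mul1r !modulusR.
Qed.

Lemma Re_gt0_near z w : modulus (w - z) < complex.Re z -> 0 < complex.Re w.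
Proof.
move=> /(le_lt_trans (Re_le_modulus _)).
by case: z w => [a ?] [b ?] /=; rewrite ltr_norml => /andP[]; lra.
Qed.

(** The norm of [Cplx R] takes its values in [Cplx R]; restating neighborhoods
    with real radii makes every estimate below an inequality between reals. *)
Lemma near_modulusP z (P : set C) :
  (\forall w \near z, P w) <->
  exists2 d : R, 0 < d & forall w, modulus (w - z) < d -> P w.
Proof.
split=> [/nbhs_ballP[e /= e0 eP]|[d d0 dP]].
  have e0' : 0 < complex.Re e by move: e0; rewrite /Cplx ltcE => /andP[].
  have eE : e = (complex.Re e)%:C%C :> C.
    by move: (ger0_Im (ltW e0)) => {e0 e0' eP}; case: e => a b /= ->.
  exists (complex.Re e) => // w wz; apply: eP.
  by rewrite -ball_normE /= eE ltr_modulus modulus_distC.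
apply/nbhs_ballP; exists (d%:C%C : C); first by rewrite /= /Cplx ltcR.
by move=> w; rewrite -ball_normE /= ltr_modulus modulus_distC; exact: dP.
Qed.

Lemma cvg_modulusP (T : Type) (F : set_system T) {FF : Filter F} (f : T -> C) z :
  f @ F --> z <-> forall e : R, 0 < e -> \forall t \near F, modulus (f t - z) < e.
Proof.
split=> [fz e e0|fz].
  have : nbhs z [set w | modulus (w - z) < e].
    by apply/near_modulusP; exists e.
  by move/fz.
move=> P /near_modulusP[d d0 dP].
by apply: filterS (fz _ d0) => t /dP.
Qed.

Lemma continuous_modulusP (G : C -> C) z :
  {for z, continuous G} <-> forall e : R, 0 < e ->
  exists2 d : R, 0 < d & forall w, modulus (w - z) < d -> modulus (G w - G z) < e.
Proof.
have cvgP := @cvg_modulusP _ (nbhs z) _ G (G z).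
split=> [/cvgP Gz e e0|Gz]; first by have /near_modulusP := Gz e e0.
by apply/cvgP => e e0; apply/near_modulusP/Gz.
Qed.

Lemma continuous_Re : continuous (@complex.Re R : C -> R).
Proof.
move=> z; apply/(@cvgrPdist_lt _ _ _ (nbhs z)) => e e0; apply/near_modulusP; exists e => // w wz.
have -> : complex.Re z - complex.Re w = complex.Re (z - w).
  by case: z w {wz} => ? ? [].
by rewrite (le_lt_trans (Re_le_modulus _))// modulus_distC.
Qed.

Lemma continuous_Im : continuous (@complex.Im R : C -> R).
Proof.
move=> z; apply/(@cvgrPdist_lt _ _ _ (nbhs z)) => e e0; apply/near_modulusP; exists e => // w wz.
have -> : complex.Im z - complex.Im w = complex.Im (z - w).
  by case: z w {wz} => ? ? [].
by rewrite (le_lt_trans (Im_le_modulus _))// modulus_distC.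
Qed.

Lemma continuous_ReIm (T : topologicalType) (f g : T -> R) t :
  {for t, continuous f} -> {for t, continuous g} ->
  {for t, continuous (fun t => Complex (f t) (g t) : C)}.
Proof.
move=> cf cg; apply/cvg_modulusP => e e0.
have e20 : 0 < e / 2 by rewrite divr_gt0.
have /cvgrPdist_lt/(_ _ e20) hf := cf.
have /cvgrPdist_lt/(_ _ e20) hg := cg.
near=> s; rewrite (le_lt_trans (modulus_le_ReIm _))//= [ltRHS]splitr.
rewrite ltrD// distrC.
- by near: s; exact: hf.
- by near: s; exact: hg.
Unshelve. all: by end_near. Qed.

Lemma derivable_modulusP (G : C -> C) z : derivable G z 1 <->
  exists d : C, forall e : R, 0 < e -> exists2 r : R, 0 < r &
  forall w, modulus (w - z) < r ->
    modulus (G w - G z - d * (w - z)) <= e * modulus (w - z).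
Proof.
split=> [/cvg_ex[d /cvg_modulusP/= dG]|[d dG]].
  exists d => e e0; move: (dG e e0).
  rewrite near_withinE => /near_modulusP[r r0 rP].
  exists r => // w wz; have [->|wz0] := eqVneq w z.
    by rewrite !subrr mulr0 subr0 modulus0 mulr0.
  have := rP (w - z); rewrite subr0 => /(_ wz); rewrite subr_eq0 => /(_ wz0).
  rewrite /= /GRing.scale/= mulr1 subrK => /ltW.
  have -> : G w - G z - d * (w - z) =
      ((w - z)^-1 * (G w - G z) - d) * (w - z).
    by rewrite mulrBl mulrAC mulVf ?mul1r// subr_eq0.
  by rewrite modulusM => ?; rewrite ler_wpM2r// modulus_ge0.
apply/cvg_ex; exists d; apply/cvg_modulusP => e e0.
have e20 : 0 < e / 2 by rewrite divr_gt0.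
have [r r0 rP] := dG _ e20.
rewrite near_withinE; apply/near_modulusP; exists r => // h; rewrite subr0 => hr h0.
have := rP (h + z); rewrite addrK => /(_ hr).
rewrite /= /GRing.scale/= mulr1 => H.
have mh0 : 0 < modulus h by rewrite modulus_gt0.
rewrite -(ltr_pM2r mh0) -modulusM mulrBl mulrAC mulVf// mul1r.
by rewrite (le_lt_trans H)// ltr_pM2r// gtr_pMr// invf_lt1// ltr1n.
Qed.

Lemma derivable_continuous (G : C -> C) z :
  derivable G z 1 -> {for z, continuous G}.
Proof. by move=> /derivable1_diffP/differentiable_continuous. Qed.

End ComplexPlane.

(** * Integrals of complex functions along segments *)

Section ComplexIntegral.
Variable R : realType.
Local Notation C := (Cplx R).
Local Notation mu := (@lebesgue_measure R).
Implicit Types (a b : R) (h k : R -> C).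

Definition Cint a b h : C :=
  Complex (\int[mu]_(x in `[a, b]) complex.Re (h x))
          (\int[mu]_(x in `[a, b]) complex.Im (h x)).

Definition cont_on a b h := {in `[a, b], continuous h}.

Lemma cont_onS a b a' b' h : a <= a' -> b' <= b ->
  cont_on a b h -> cont_on a' b' h.
Proof. by move=> aa bb ch x xab; apply: ch; apply: subset_itv xab; rewrite bnd_simp. Qed.

Lemma cont_onD a b h k : cont_on a b h -> cont_on a b k ->
  cont_on a b (fun x => h x + k x).
Proof. by move=> ch ck x xab; exact: (continuousD (ch x xab) (ck x xab)). Qed.

Lemma cont_onN a b h : cont_on a b h -> cont_on a b (fun x => - h x).
Proof. by move=> ch x xab; exact: (continuousN (ch x xab)). Qed.

Lemma cont_onB a b h k : cont_on a b h -> cont_on a b k ->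
  cont_on a b (fun x => h x - k x).
Proof. by move=> ch ck; exact: (cont_onD ch (cont_onN ck)). Qed.

Lemma cont_onM a b h k : cont_on a b h -> cont_on a b k ->
  cont_on a b (fun x => h x * k x).
Proof. by move=> ch ck x xab; exact: (continuousM (ch x xab) (ck x xab)). Qed.

Lemma cont_on_cst a b (c : C) : cont_on a b (fun=> c).
Proof. by move=> x _; exact: cst_continuous. Qed.

Lemma integrable_Re a b h : cont_on a b h ->
  mu.-integrable `[a, b] (EFin \o (@complex.Re R \o h)).
Proof.
move=> ch; apply: continuous_compact_integrable; first exact: segment_compact.
apply: continuous_in_subspaceT => x xab; apply: continuous_comp.
  by apply: ch; rewrite inE in xab.
exact: continuous_Re.
Qed.

Lemma integrable_Im a b h : cont_on a b h ->
  mu.-integrable `[a, b] (EFin \o (@complex.Im R \o h)).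
Proof.
move=> ch; apply: continuous_compact_integrable; first exact: segment_compact.
apply: continuous_in_subspaceT => x xab; apply: continuous_comp.
  by apply: ch; rewrite inE in xab.
exact: continuous_Im.
Qed.

Lemma eq_Cint a b h k : {in `[a, b], h =1 k} -> Cint a b h = Cint a b k.
Proof.
by move=> hk; congr Complex; apply: eq_Rintegral => x; rewrite inE/= => /hk ->.
Qed.

Lemma CintD a b h k : cont_on a b h -> cont_on a b k ->
  Cint a b (fun x => h x + k x) = Cint a b h + Cint a b k.
Proof.
move=> ch ck; rewrite /Cint; apply/eqP; rewrite eq_complex /=; apply/andP; split; apply/eqP.
  rewrite -RintegralD//; [|exact: integrable_Re|exact: integrable_Re].
  by apply: eq_Rintegral => x _; case: (h x) (k x) => ? ? [].
rewrite -RintegralD//; [|exact: integrable_Im|exact: integrable_Im].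
by apply: eq_Rintegral => x _; case: (h x) (k x) => ? ? [].
Qed.

Lemma CintZ a b (c : C) h : cont_on a b h ->
  Cint a b (fun x => c * h x) = c * Cint a b h.
Proof.
move=> ch; have ir := integrable_Re ch; have ii := integrable_Im ch.
rewrite /Cint; case: c => u v; apply/eqP; rewrite eq_complex /=; apply/andP; split; apply/eqP.
  rewrite -!RintegralZl// -RintegralB//; last 2 first.
  - exact: (integrableZl _ _ ir).
  - exact: (integrableZl _ _ ii).
  by apply: eq_Rintegral => x _; case: (h x).
rewrite -!RintegralZl// -RintegralD//; last 2 first.
- exact: (integrableZl _ _ ii).
- exact: (integrableZl _ _ ir).
by apply: eq_Rintegral => x _; case: (h x).
Qed.

Lemma CintB a b h k : cont_on a b h -> cont_on a b k ->
  Cint a b (fun x => h x - k x) = Cint a b h - Cint a b k.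
Proof.
move=> ch ck; rewrite -[in RHS]mulN1r -(CintZ (-1) ck).
have cNk : cont_on a b (fun x => -1 * k x).
  exact: (cont_onM (@cont_on_cst a b (-1)) ck).
by rewrite -(CintD ch cNk); apply: eq_Cint => x _; rewrite mulN1r.
Qed.

Lemma length_itvcc a b : a <= b -> fine (mu `[a, b]%classic) = b - a.
Proof.
move=> ab; rewrite lebesgue_measure_itv/= lte_fin.
case: ifPn => //; rewrite -leNgt => ba.
by rewrite (_ : b = a) ?subrr//; apply/le_anti/andP.
Qed.

Lemma Cint_cst a b (c : C) : a <= b -> Cint a b (fun=> c) = (b - a)%:C%C * c.
Proof.
move=> ab; rewrite /Cint !Rintegral_cst// !length_itvcc//.
by case: c => u v; apply/eqP; rewrite eq_complex /=; apply/andP; split; apply/eqP; ring.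
Qed.

Lemma Rintegral_norm_le a b (g : R -> R) (K : R) : a <= b ->
  mu.-integrable `[a, b] (EFin \o g) -> {in `[a, b], forall x, `|g x| <= K} ->
  `|\int[mu]_(x in `[a, b]) g x| <= K * (b - a).
Proof.
move=> ab ig gK; apply: (le_trans (le_normr_Rintegral _ ig)) => //.
apply: (@le_trans _ _ (\int[mu]_(x in `[a, b]) K)).
  apply: le_Rintegral => //.
  - by have /integrable_norm := ig.
  - apply: continuous_compact_integrable; first exact: segment_compact.
    by apply: continuous_subspaceT => x; exact: cst_continuous.
by rewrite Rintegral_cst// length_itvcc.
Qed.

(** Bounding real and imaginary parts separately loses a factor 2, which is
    harmless below. *)
Lemma Cint_le a b h (K : R) : a <= b -> cont_on a b h ->
  {in `[a, b], forall x, modulus (h x) <= K} ->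
  modulus (Cint a b h) <= 2 * K * (b - a).
Proof.
move=> ab ch hK; apply: (le_trans (modulus_le_ReIm _)).
rewrite [2 * K]mulrDl mul1r mulrDl lerD// Rintegral_norm_le//.
- exact: integrable_Re ch.
- by move=> x xab; rewrite (le_trans (Re_le_modulus _))// hK.
- exact: integrable_Im ch.
- by move=> x xab; rewrite (le_trans (Im_le_modulus _))// hK.
Qed.

Lemma Cint_split a c b h : a <= c -> c <= b -> cont_on a b h ->
  Cint a b h = Cint a c h + Cint c b h.
Proof.
move=> ac cb ch.
have split g : mu.-integrable `[a, b] (EFin \o g) ->
    \int[mu]_(x in `[a, b]) g x =
    \int[mu]_(x in `[a, c]) g x + \int[mu]_(x in `[c, b]) g x.
  move=> ig; apply/eqP; rewrite addrC -subr_eq; apply/eqP.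
  rewrite (@Rintegral_itvB R g (BLeft a) (BRight b) c)//.
  rewrite Rintegral_itv_obnd_cbnd//; apply: integrableS ig => //.
  by apply: subset_itvr; rewrite bnd_simp.
rewrite /Cint; apply/eqP; rewrite eq_complex /=; apply/andP; split; apply/eqP.
- exact: (split _ (integrable_Re ch)).
- exact: (split _ (integrable_Im ch)).
Qed.

End ComplexIntegral.

(** * Cauchy's theorem for rectangles *)

Section Goursat.
Variable R : realType.
Local Notation C := (Cplx R).
Implicit Types (G : C -> C) (x y : R).

Definition hol_rect G x1 x2 y1 y2 := forall x y,
  x1 <= x <= x2 -> y1 <= y <= y2 -> derivable G (Complex x y) 1.

Lemma hol_rectS G x1 x2 y1 y2 x1' x2' y1' y2' :
  x1 <= x1' -> x2' <= x2 -> y1 <= y1' -> y2' <= y2 ->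
  hol_rect G x1 x2 y1 y2 -> hol_rect G x1' x2' y1' y2'.
Proof.
move=> hx1 hx2 hy1 hy2 hG x y /andP[xl xr] /andP[yl yr]; apply: hG.
  by rewrite (le_trans hx1 xl) (le_trans xr hx2).
by rewrite (le_trans hy1 yl) (le_trans yr hy2).
Qed.

Lemma cont_on_hor G x1 x2 y1 y2 y : hol_rect G x1 x2 y1 y2 -> y1 <= y <= y2 ->
  cont_on x1 x2 (fun x => G (Complex x y)).
Proof.
move=> hG yy x; rewrite in_itv/= => xx.
have ch : {for x, continuous (fun x => Complex x y : C)}.
  by apply: continuous_ReIm; [exact: cvg_id|exact: cst_continuous].
exact: (continuous_comp ch (derivable_continuous (hG x y xx yy))).
Qed.

Lemma cont_on_ver G x1 x2 y1 y2 x : hol_rect G x1 x2 y1 y2 -> x1 <= x <= x2 ->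
  cont_on y1 y2 (fun y => G (Complex x y)).
Proof.
move=> hG xx y; rewrite in_itv/= => yy.
have ch : {for y, continuous (fun y => Complex x y : C)}.
  by apply: continuous_ReIm; [exact: cst_continuous|exact: cvg_id].
exact: (continuous_comp ch (derivable_continuous (hG x y xx yy))).
Qed.

(** The integral of [G] along the boundary of a rectangle.  Opposite sides are
    paired under one integral, so that the affine part of [G] contributes only
    constant integrands. *)
Definition rect_int G x1 x2 y1 y2 : C :=
  Cint x1 x2 (fun x => G (Complex x y1) - G (Complex x y2)) +
  'i%C * Cint y1 y2 (fun y => G (Complex x2 y) - G (Complex x1 y)).

Lemma rect_int_splitx G x1 xm x2 y1 y2 : x1 <= xm -> xm <= x2 -> y1 <= y2 ->
  hol_rect G x1 x2 y1 y2 ->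
  rect_int G x1 x2 y1 y2 = rect_int G x1 xm y1 y2 + rect_int G xm x2 y1 y2.
Proof.
move=> h1 h2 hy hG; have h12 := le_trans h1 h2.
have v x (xx : x1 <= x <= x2) := cont_on_ver hG xx.
have v1 : x1 <= x1 <= x2 by rewrite lexx.
have v2 : x1 <= x2 <= x2 by rewrite lexx andbT.
have vm : x1 <= xm <= x2 by rewrite h1.
have u1 : y1 <= y1 <= y2 by rewrite lexx.
have u2 : y1 <= y2 <= y2 by rewrite lexx andbT.
rewrite /rect_int (Cint_split h1 h2); last first.
  exact: (cont_onB (cont_on_hor hG u1) (cont_on_hor hG u2)).
rewrite !CintB; do ?[exact: v].
- by ring.
all: apply: (@cont_onS _ x1 x2) => //; apply: (cont_on_hor hG) => //.
Qed.

Lemma rect_int_splity G x1 x2 y1 ym y2 : x1 <= x2 -> y1 <= ym -> ym <= y2 ->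
  hol_rect G x1 x2 y1 y2 ->
  rect_int G x1 x2 y1 y2 = rect_int G x1 x2 y1 ym + rect_int G x1 x2 ym y2.
Proof.
move=> hx h1 h2 hG; have h12 := le_trans h1 h2.
have v y (yy : y1 <= y <= y2) := cont_on_hor hG yy.
have v1 : x1 <= x1 <= x2 by rewrite lexx.
have v2 : x1 <= x2 <= x2 by rewrite lexx andbT.
have u1 : y1 <= y1 <= y2 by rewrite lexx.
have u2 : y1 <= y2 <= y2 by rewrite lexx andbT.
have um : y1 <= ym <= y2 by rewrite h1.
rewrite /rect_int (Cint_split h1 h2); last first.
  exact: (cont_onB (cont_on_ver hG v2) (cont_on_ver hG v1)).
rewrite !CintB; do ?[exact: v].
- by ring.
all: apply: (@cont_onS _ y1 y2) => //; apply: (cont_on_ver hG) => //.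
Qed.

(** The boundary integral of the affine function with slope [d] vanishes, and
    only the deviation from it counts.  Near a point where [G] has derivative
    [d] this makes the boundary integral small of second order. *)
Lemma rect_int_le G x1 x2 y1 y2 (c d : C) (e : R) : x1 <= x2 -> y1 <= y2 ->
  hol_rect G x1 x2 y1 y2 ->
  (forall x y, x1 <= x <= x2 -> y1 <= y <= y2 ->
    modulus (G (Complex x y) - G c - d * (Complex x y - c)) <= e) ->
  modulus (rect_int G x1 x2 y1 y2) <= 4 * e * ((x2 - x1) + (y2 - y1)).
Proof.
move=> hx hy hG hd.
have v1 : x1 <= x1 <= x2 by rewrite lexx.
have v2 : x1 <= x2 <= x2 by rewrite lexx andbT.
have u1 : y1 <= y1 <= y2 by rewrite lexx.
have u2 : y1 <= y2 <= y2 by rewrite lexx andbT.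
pose kx : C := d * ('i%C * (y1 - y2)%:C%C); pose ky : C := d * (x2 - x1)%:C%C.
have chx := cont_onB (cont_on_hor hG u1) (cont_on_hor hG u2).
have chy := cont_onB (cont_on_ver hG v2) (cont_on_ver hG v1).
have xE x y : Complex x y = x%:C%C + 'i%C * y%:C%C :> C by exact: (complexE (Complex x y : C)).
have -> : rect_int G x1 x2 y1 y2 =
    Cint x1 x2 (fun x => G (Complex x y1) - G (Complex x y2) - kx) +
    'i%C * Cint y1 y2 (fun y => G (Complex x2 y) - G (Complex x1 y) - ky).
  rewrite (CintB chx (@cont_on_cst _ _ _ _)) (CintB chy (@cont_on_cst _ _ _ _)).
  rewrite !Cint_cst// /rect_int /kx /ky !rmorphB/=.
  by ring.
have e2 u v : modulus u <= e -> modulus v <= e -> modulus (u - v : C) <= 2 * e.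
  by move=> ue ve; rewrite mulrDl mul1r (le_trans (modulusB _ _))// lerD.
apply: (le_trans (modulusD _ _)); rewrite modulusM modulusi mul1r mulrDr.
have -> : 4 * e = 2 * (2 * e) by ring.
apply: lerD.
  apply: (Cint_le hx (cont_onB chx (@cont_on_cst _ _ _ kx))) => x.
  rewrite in_itv/= => xx.
  have -> : G (Complex x y1) - G (Complex x y2) - kx =
     (G (Complex x y1) - G c - d * (Complex x y1 - c)) -
     (G (Complex x y2) - G c - d * (Complex x y2 - c)).
    by rewrite /kx (xE x y1) (xE x y2) !rmorphB/=; ring.
  by apply: e2; exact: hd.
apply: (Cint_le hy (cont_onB chy (@cont_on_cst _ _ _ ky))) => y.
rewrite in_itv/= => yy.
have -> : G (Complex x2 y) - G (Complex x1 y) - ky =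
   (G (Complex x2 y) - G c - d * (Complex x2 y - c)) -
   (G (Complex x1 y) - G c - d * (Complex x1 y - c)).
  by rewrite /ky (xE x1 y) (xE x2 y) !rmorphB/=; ring.
by apply: e2; exact: hd.
Qed.

Lemma modulus_add4_lt (a b c d : C) (e : R) :
  modulus a < e -> modulus b < e -> modulus c < e -> modulus d < e ->
  modulus (a + b + (c + d)) < 4 * e.
Proof.
move=> ha hb hc hd; apply: (le_lt_trans (modulusD _ _)).
have -> : 4 * e = (e + e) + (e + e) by ring.
by rewrite ltrD// (le_lt_trans (modulusD _ _))// ltrD.
Qed.

(** The boundary integrals of the four quarters add up to that of the whole
    rectangle, so they cannot all be small: one step of the bisection. *)
Lemma rect_int_quarter G (x y l m e : R) : 0 <= l -> 0 <= m ->
  hol_rect G x (x + l) y (y + m) ->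
  4 * e <= modulus (rect_int G x (x + l) y (y + m)) ->
  exists x' y', [/\ x <= x', x' + l / 2 <= x + l, y <= y', y' + m / 2 <= y + m
    & e <= modulus (rect_int G x' (x' + l / 2) y' (y' + m / 2))].
Proof.
move=> l0 m0 hG; have l20 : 0 <= l / 2 by rewrite divr_ge0.
have m20 : 0 <= m / 2 by rewrite divr_ge0.
have xh : x + l / 2 + l / 2 = x + l by rewrite -addrA -splitr.
have yh : y + m / 2 + m / 2 = y + m by rewrite -addrA -splitr.
have hx1 : x <= x + l / 2 by rewrite lerDl.
have hy1 : y <= y + m / 2 by rewrite lerDl.
have hx2 : x + l / 2 <= x + l by rewrite -xh lerDl.
have hy2 : y + m / 2 <= y + m by rewrite -yh lerDl.
have hx := le_trans hx1 hx2; have hy := le_trans hy1 hy2.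
rewrite (rect_int_splitx hx1 hx2 hy hG).
rewrite (rect_int_splity hx1 hy1 hy2); last exact: hol_rectS hG.
rewrite (rect_int_splity hx2 hy1 hy2); last exact: hol_rectS hG.
move=> he; apply: contrapT => no.
have small x' y' : x <= x' -> x' + l / 2 <= x + l -> y <= y' -> y' + m / 2 <= y + m ->
    modulus (rect_int G x' (x' + l / 2) y' (y' + m / 2)) < e.
  by move=> ? ? ? ?; rewrite ltNge; apply/negP => ?; apply: no; exists x', y'.
have s1 := small x y (lexx _) hx2 (lexx _) hy2.
have s2 := small x (y + m / 2) (lexx _) hx2 hy1; rewrite yh lexx in s2.
have s3 := small (x + l / 2) y hx1; rewrite xh lexx in s3.
have s4 := small (x + l / 2) (y + m / 2) hx1; rewrite xh yh !lexx in s4.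
by have := modulus_add4_lt s1 (s2 isT) (s3 isT (lexx _) hy2) (s4 isT hy1 isT); rewrite ltNge he.
Qed.

Lemma nested_intervals (a : nat -> R) (l : R) : 0 <= l ->
  (forall n, a n <= a n.+1) ->
  (forall n, a n.+1 + l / 2 ^+ n.+1 <= a n + l / 2 ^+ n) ->
  exists c, forall n, a n <= c <= a n + l / 2 ^+ n.
Proof.
move=> l0 ha hb; pose A := [set a n | n in [set: nat]].
have mono m n : (m <= n)%N -> a m <= a n.
  elim: n => [|n IH]; first by rewrite leqn0 => /eqP ->.
  rewrite leq_eqVlt => /predU1P[->//|]; rewrite ltnS => /IH h.
  exact: le_trans h (ha n).
have antimono m n : (m <= n)%N -> a n + l / 2 ^+ n <= a m + l / 2 ^+ m.
  elim: n => [|n IH]; first by rewrite leqn0 => /eqP ->.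
  rewrite leq_eqVlt => /predU1P[->//|]; rewrite ltnS => /IH h.
  exact: le_trans (hb n) h.
have ub n : ubound A (a n + l / 2 ^+ n).
  move=> _ [m _ <-]; have [mn|/ltnW nm] := leqP m n.
    by rewrite (le_trans (mono _ _ mn))// lerDl divr_ge0.
  by rewrite (le_trans _ (antimono _ _ nm))// lerDl divr_ge0.
exists (sup A) => n; apply/andP; split.
  by apply: ub_le_sup; [exists (a 0%N + l / 2 ^+ 0); exact: ub|exists n].
by apply: ge_sup => //; exists (a 0%N), 0%N.
Qed.

(** Bisecting a rectangle with nonzero boundary integral [e] yields nested
    rectangles whose boundary integrals are at least [e / 4 ^+ n]; but they
    shrink to a point where [G] is differentiable, and there the boundary
    integral is of smaller order than the square of the side length. *)
Theorem goursat G x1 x2 y1 y2 : x1 <= x2 -> y1 <= y2 ->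
  hol_rect G x1 x2 y1 y2 -> rect_int G x1 x2 y1 y2 = 0.
Proof.
move=> hx hy hG; apply/eqP; rewrite -modulus_eq0; apply: contraT => F0.
pose e := modulus (rect_int G x1 x2 y1 y2).
have e0 : 0 < e by rewrite lt_def F0 modulus_ge0.
pose l := x2 - x1; pose m := y2 - y1.
have l0 : 0 <= l by rewrite subr_ge0.
have m0 : 0 <= m by rewrite subr_ge0.
pose good (n : nat) (p : R * R) := [/\ x1 <= p.1, p.1 + l / 2 ^+ n <= x2,
  y1 <= p.2, p.2 + m / 2 ^+ n <= y2 &
  e / 4 ^+ n <= modulus (rect_int G p.1 (p.1 + l / 2 ^+ n) p.2 (p.2 + m / 2 ^+ n))].
pose T := {np : nat * (R * R) | good np.1 np.2}.
pose next (s t : T) := [/\ (sval t).1 = (sval s).1.+1,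
  (sval s).2.1 <= (sval t).2.1,
  (sval t).2.1 + l / 2 ^+ (sval t).1 <= (sval s).2.1 + l / 2 ^+ (sval s).1,
  (sval s).2.2 <= (sval t).2.2 &
  (sval t).2.2 + m / 2 ^+ (sval t).1 <= (sval s).2.2 + m / 2 ^+ (sval s).1].
have pow2 n : 0 < 2 ^+ n :> R by rewrite exprn_gt0.
have halve (k : R) n : k / 2 ^+ n.+1 = k / 2 ^+ n / 2.
  by rewrite exprSr invfM mulrA mulrAC.
have step (s : T) : {t : T | next s t}.
  apply: cid; case: s => -[n [x y]] [/= hx1 hx2 hy1 hy2 he].
  have ln0 : 0 <= l / 2 ^+ n by rewrite divr_ge0// ltW.
  have mn0 : 0 <= m / 2 ^+ n by rewrite divr_ge0// ltW.
  have hGs : hol_rect G x (x + l / 2 ^+ n) y (y + m / 2 ^+ n) by apply: hol_rectS hG.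
  have he' : 4 * (e / 4 ^+ n.+1) <=
      modulus (rect_int G x (x + l / 2 ^+ n) y (y + m / 2 ^+ n)).
    by rewrite exprS invfM mulrCA mulVKf//= he.
  have [x' [y' [xx' xl' yy' yl' he'']]] := rect_int_quarter ln0 mn0 hGs he'.
  rewrite -!halve in xl' yl' he''.
  have gt : good n.+1 (x', y').
    split => /=; [exact: le_trans xx'|exact: le_trans hx2|
                  exact: le_trans yy'|exact: le_trans hy2|exact: he''].
  by exists (exist (fun np => good np.1 np.2) (n.+1, (x', y')) gt).
have good0 : good 0%N (x1, y1).
  by rewrite /good /= !expr0 !divr1 /l /m !subrKC !lexx.
have [s [s0 snext]] := dependent_choice step
  (exist (fun np => good np.1 np.2) (0%N, (x1, y1)) good0 : T).
have sn n : (sval (s n)).1 = n.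
  by elim: n => [|n IH]; [rewrite s0|have [-> _ _ _ _] := snext n; rewrite IH].
have [cx hcx] : exists c, forall n, (sval (s n)).2.1 <= c <= (sval (s n)).2.1 + l / 2 ^+ n.
  apply: nested_intervals => // n; have [_ h1 h2 _ _] := snext n => //.
  by rewrite !sn in h2.
have [cy hcy] : exists c, forall n, (sval (s n)).2.2 <= c <= (sval (s n)).2.2 + m / 2 ^+ n.
  apply: nested_intervals => // n; have [_ _ _ h1 h2] := snext n => //.
  by rewrite !sn in h2.
have derc : derivable G (Complex cx cy) 1.
  have [g1 g2 g3 g4 _] := svalP (s 0%N); rewrite sn in g2 g4.
  have /andP[hx1 hx2] := hcx 0%N; have /andP[hy1 hy2] := hcy 0%N.
  by apply: hG; apply/andP; split; [exact: le_trans hx1|exact: le_trans g2|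
     exact: le_trans hy1|exact: le_trans g4].
have /derivable_modulusP[d hd] := derc.
pose k := l + m; have k0 : 0 <= k by rewrite addr_ge0.
(* small enough for [4 * eta * k ^+ 2 < e] *)
pose eta := e / (8 * (k + 1) ^+ 2).
have k1 : 0 < k + 1 by rewrite ltr_wpDl.
have eta0 : 0 < eta by rewrite divr_gt0// mulr_gt0// exprn_gt0.
have [r r0 hr] := hd _ eta0.
have [n hn] : exists n, k / 2 ^+ n < r.
  have : geometric k (2^-1 : R) @ \oo --> (0 : R).
    by apply: cvg_geometric; rewrite ger0_norm ?invr_ge0// invf_lt1 ?ltr1n.
  move=> /cvgrPdist_lt/(_ _ r0)[N _ hN]; exists N.
  have := hN N (leqnn N); rewrite /= sub0r normrN exprVn ger0_norm//.
  by rewrite divr_ge0// ltW.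
have [gx1 gx2 gy1 gy2 ge] := svalP (s n).
rewrite sn in gx2 gy2 ge.
move: (sval (s n)).2.1 (sval (s n)).2.2 gx1 gx2 gy1 gy2 ge (hcx n) (hcy n).
move=> x y gx1 gx2 gy1 gy2 ge /andP[c1 c2] /andP[c3 c4].
have ln0 : 0 <= l / 2 ^+ n by rewrite divr_ge0// ltW.
have mn0 : 0 <= m / 2 ^+ n by rewrite divr_ge0// ltW.
have kn : k / 2 ^+ n = l / 2 ^+ n + m / 2 ^+ n by rewrite mulrDl.
have near u v : x <= u <= x + l / 2 ^+ n -> y <= v <= y + m / 2 ^+ n ->
    modulus (Complex u v - Complex cx cy : C) <= k / 2 ^+ n.
  move=> /andP[u1 u2] /andP[v1 v2]; apply: (le_trans (modulus_le_ReIm _)) => /=.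
  rewrite kn; apply: lerD; rewrite ler_norml.
    by clear -u1 u2 c1 c2; apply/andP; split; lra.
  by clear -v1 v2 c3 c4; apply/andP; split; lra.
have bound : modulus (rect_int G x (x + l / 2 ^+ n) y (y + m / 2 ^+ n)) <=
    4 * (eta * (k / 2 ^+ n)) * (k / 2 ^+ n).
  have -> : 4 * (eta * (k / 2 ^+ n)) * (k / 2 ^+ n) = 4 * (eta * (k / 2 ^+ n)) *
     ((x + l / 2 ^+ n - x) + (y + m / 2 ^+ n - y)).
    by rewrite kn !(addrC x) !(addrC y) !addrK.
  have hxl : x <= x + l / 2 ^+ n by rewrite lerDl.
  have hyl : y <= y + m / 2 ^+ n by rewrite lerDl.
  apply: (rect_int_le (c := Complex cx cy) (d := d) hxl hyl).
    exact: hol_rectS gx1 gx2 gy1 gy2 hG.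
  move=> u v hu hv; have nuv := near u v hu hv.
  apply: (le_trans (hr _ (le_lt_trans nuv hn))).
  by rewrite ler_pM2l.
have := le_trans ge bound.
have -> : 4 * (eta * (k / 2 ^+ n)) * (k / 2 ^+ n) =
    e / 4 ^+ n * (2^-1 * (k / (k + 1)) ^+ 2).
  have four : 4 ^+ n = 2 ^+ n * 2 ^+ n :> R by rewrite -exprMn -natrM.
  have k1' : k + 1 != 0 by rewrite gt_eqF.
  have pow2' : 2 ^+ n != 0 :> R by rewrite gt_eqF.
  rewrite four /eta; clear -k1' pow2'; field.
  by rewrite k1' pow2'.
rewrite ler_pMr ?divr_gt0 ?exprn_gt0//.
have kk : (k / (k + 1)) ^+ 2 <= 1.
  by rewrite expr_le1// ?divr_ge0 ?ler_pdivrMr ?mul1r ?lerDl// ltW.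
by move=> h; exfalso; lra.
Qed.

End Goursat.

(** * Partial sums of the exponential series *)

Section ExpPartialSums.
Variable F : numFieldType.
Implicit Types z w : F.

Definition exp_sum (n : nat) z : F := \sum_(k < n) k`!%:R^-1 * z ^+ k.

Definition exp_poly (n : nat) z : {poly F} := \poly_(k < n) (k`!%:R^-1 * z ^+ k).

Lemma exp_poly_horner1 n z : (exp_poly n z).[1] = exp_sum n z.
Proof.
by rewrite /exp_poly horner_poly; apply: eq_bigr => k _; rewrite expr1n mulr1.
Qed.

Lemma fact_neq0 n : n`!%:R != 0 :> F.
Proof. by rewrite pnatr_eq0 -lt0n fact_gt0. Qed.

Lemma coef_exp_polyM n z w k : (k < n)%N ->
  (exp_poly n z * exp_poly n w)`_k = k`!%:R^-1 * (z + w) ^+ k.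
Proof.
move=> kn; rewrite coefM addrC exprDn mulr_sumr; apply: eq_bigr => -[i /=].
rewrite ltnS => ik _; rewrite !coef_poly (leq_ltn_trans ik kn).
rewrite (leq_ltn_trans (leq_subr _ _) kn) -(bin_fact ik) !natrM !invfM.
rewrite -[_ * _ *+ _]mulr_natl.
have id3 (u v c s t : F) : u != 0 -> v != 0 -> c != 0 ->
    u^-1 * s * (v^-1 * t) = c^-1 * (u^-1 * v^-1) * (c * (t * s)).
  by move=> u0 v0 c0; field; rewrite u0 v0 c0.
by apply: id3; rewrite ?fact_neq0// pnatr_eq0 -lt0n bin_gt0.
Qed.

(** The product of two partial sums is a product of polynomials evaluated at
    [1]; its coefficients of degree below [n] are those of the partial sum at
    [z + w], by the binomial formula. *)
Lemma exp_sumM n z w : exp_sum n z * exp_sum n w =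
  exp_sum n (z + w) + \sum_(k < n) (exp_poly n z * exp_poly n w)`_(n + k).
Proof.
rewrite -!exp_poly_horner1 -hornerM.
rewrite (@horner_coef_wide _ (n + n)); last first.
  apply: (leq_trans (size_polyMleq _ _)); apply: (leq_trans (leq_pred _)).
  by rewrite leq_add// size_poly.
rewrite big_split_ord /= exp_poly_horner1; congr (_ + _).
  by apply: eq_bigr => k _; rewrite expr1n mulr1 coef_exp_polyM.
by apply: eq_bigr => k _; rewrite expr1n mulr1.
Qed.

End ExpPartialSums.

(** * The complex exponential and the principal logarithm *)

Section ComplexExponential.
Variable R : realType.
Local Notation C := (Cplx R).
Implicit Types (z w : C) (x y t M : R).

Let simp0 := (mul0r, mul1r, mulr0, mulr1, subr0, sub0r, add0r, addr0, oppr0).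

Definition cexp z : C :=
  Complex (expR (complex.Re z) * cos (complex.Im z))
          (expR (complex.Re z) * sin (complex.Im z)).

Lemma cexpE x y :
  cexp (Complex x y) = (expR x)%:C%C * Complex (cos y) (sin y).
Proof. by rewrite /cexp/=; apply/eqP; rewrite eq_complex/= !simp0 !eqxx. Qed.

Lemma cexp0 : cexp 0 = 1.
Proof. by apply/eqP; rewrite eq_complex/= expR0 cos0 sin0 mulr1 mulr0 !eqxx. Qed.

Lemma cexpD z w : cexp (z + w) = cexp z * cexp w.
Proof.
case: z w => [a b] [c d]; apply/eqP; rewrite eq_complex/= expRD cosD sinD.
by apply/andP; split; apply/eqP; ring.
Qed.

Lemma cexpN z : cexp (- z) = (cexp z)^-1.
Proof.
have h : cexp (- z) * cexp z = 1 by rewrite -cexpD addNr cexp0.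
have z0 : cexp z != 0.
  by apply: contra_eq_neq h => ->; rewrite mulr0 eq_sym oner_eq0.
by apply: (mulIf z0); rewrite h mulVf.
Qed.

Lemma cexp_neq0 z : cexp z != 0.
Proof.
have h : cexp (- z) * cexp z = 1 by rewrite -cexpD addNr cexp0.
by apply: contra_eq_neq h => ->; rewrite mulr0 eq_sym oner_eq0.
Qed.

Lemma modulus_cexp z : modulus (cexp z) = expR (complex.Re z).
Proof.
rewrite /modulus /Cplx normc_def /= !exprMn -mulrDr cos2Dsin2 mulr1 sqrtr_sqr.
by rewrite ger0_norm// expR_ge0.
Qed.

Lemma modulus_sum n (f : 'I_n -> C) : modulus (\sum_(k < n) f k) <= \sum_(k < n) modulus (f k).
Proof.
elim/big_ind2 : _ => [|u a v b ua vb|//]; first by rewrite modulus0.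
exact: le_trans (modulusD _ _) (lerD ua vb).
Qed.

Lemma modulus_natV n : modulus (n%:R^-1 : C) = n%:R^-1.
Proof.
rewrite modulusV -(rmorph_nat (real_complex R)) modulusR.
by rewrite ger0_norm.
Qed.

Lemma modulus_exp_sumB n m z M : modulus z <= M -> (n <= m)%N ->
  modulus (exp_sum m z - exp_sum n z) <= exp_sum m M - exp_sum n M.
Proof.
move=> zM /subnKC <-; rewrite /exp_sum !big_split_ord/= !(addrC (\sum_(i < n) _)) !addrK.
apply: (le_trans (modulus_sum _)); apply: ler_sum => k _.
rewrite modulusM modulus_natV modulusX ler_wpM2l ?invr_ge0//.
by rewrite lerXn2r// nnegrE ?modulus_ge0// (le_trans (modulus_ge0 _) zM).
Qed.

(** The error in the functional equation is dominated, term by term, by the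
    error for the real series, which tends to [0]. *)
Lemma modulus_exp_sumM n z w :
  modulus (exp_sum n z * exp_sum n w - exp_sum n (z + w)) <=
  exp_sum n (modulus z) * exp_sum n (modulus w) - exp_sum n (modulus z + modulus w).
Proof.
rewrite !exp_sumM ![exp_sum n (_ + _) + _]addrC !addrK.
apply: (le_trans (modulus_sum _)); apply: ler_sum => k _; rewrite !coefM.
apply: (le_trans (modulus_sum _)); apply: ler_sum => i _; rewrite !coef_poly.
rewrite modulusM; case: ifP => _; case: ifP => _;
  rewrite ?modulus0 ?mul0r ?mulr0// !modulusM !modulusX !modulus_natV.
exact: lexx.
Qed.

Lemma exp_sum_series x : (exp_sum (F := R))^~ x = series (exp_coeff x).
Proof.
apply/funext => n; rewrite /exp_sum /series/= big_mkord.
by apply: eq_bigr => k _; rewrite mulrC.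
Qed.

Lemma cvg_exp_sumR x : exp_sum n x @[n --> \oo] --> expR x.
Proof. by rewrite exp_sum_series; exact: is_cvg_series_exp_coeff. Qed.

Lemma exp_sum_le_expR n x : 0 <= x -> exp_sum n x <= expR x.
Proof.
move=> x0; have cx := @cvg_exp_sumR x.
rewrite -(cvg_lim (@Rhausdorff R) cx); apply: nondecreasing_cvgn_le; last first.
  by apply/cvg_ex; exists (expR x).
apply/nondecreasing_seqP => m; rewrite /exp_sum big_ord_recr/= lerDl.
by rewrite mulr_ge0 ?invr_ge0// exprn_ge0.
Qed.

Lemma exp_sum_real n x : exp_sum n (x%:C%C : C) = (exp_sum n x)%:C%C.
Proof.
rewrite /exp_sum rmorph_sum/=; apply: eq_bigr => k _.
by rewrite rmorphM/= fmorphV/= rmorphXn/= rmorph_nat.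
Qed.

Lemma exprn_i k : ('i%C : C) ^+ k =
  Complex ((~~ odd k)%:R * (-1) ^+ k./2) ((odd k)%:R * (-1) ^+ k.-1./2).
Proof.
have i2 m : ('i%C : C) ^+ m.*2 = ((-1) ^+ m)%:C%C.
  by rewrite -muln2 mulnC exprM sqr_i rmorphXn/= rmorphN1.
rewrite -[in LHS](odd_double_half k).
case ok : (odd k) => /=.
  rewrite exprS i2 -[in k.-1./2](odd_double_half k) ok /= doubleK mul0r mul1r.
  by apply/eqP; rewrite eq_complex/= !simp0 !eqxx.
by rewrite add0n i2 mul1r mul0r.
Qed.

Lemma exp_sum_imag n y : exp_sum n (Complex 0 y : C) =
  Complex (series (cos_coeff y) n) (series (sin_coeff y) n).
Proof.
have yE : Complex 0 y = 'i%C * y%:C%C :> C.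
  by apply/eqP; rewrite eq_complex/= !simp0 !eqxx.
rewrite yE /exp_sum /series/= !big_mkord; apply/eqP; rewrite eq_complex/=.
rewrite (big_morph (@complex.Re R) (id1 := 0) (op1 := +%R)) //; last by case=> ? ? [].
rewrite (big_morph (@complex.Im R) (id1 := 0) (op1 := +%R)) //; last by case=> ? ? [].
by apply/andP; split; apply/eqP; apply: eq_bigr => k _;
  rewrite exprMn exprn_i -(rmorph_nat (real_complex R)) -fmorphV/= -rmorphXn/=;
  rewrite !simp0 mulrC.
Qed.

Lemma cvg_exp_sum z : exp_sum n z @[n --> \oo] --> cexp z.
Proof.
have zE : z = (complex.Re z)%:C%C + Complex 0 (complex.Im z).
  by case: z => a b; apply/eqP; rewrite eq_complex/= !simp0 !eqxx.
move: zE; set x := (complex.Re z)%:C%C; set w := Complex 0 (complex.Im z) => zE.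
have cw : exp_sum n w @[n --> \oo] --> cexp w.
  rewrite /w /cexp /= expR0 !mul1r.
  under eq_fun do rewrite exp_sum_imag.
  have cc : series (cos_coeff (complex.Im z)) @ \oo --> cos (complex.Im z).
    by rewrite unlock; exact: is_cvg_series_cos_coeff.
  have cs : series (sin_coeff (complex.Im z)) @ \oo --> sin (complex.Im z).
    by rewrite unlock; exact: is_cvg_series_sin_coeff.
  apply/cvg_modulusP => e e0; have e20 : 0 < e / 2 by rewrite divr_gt0.
  near=> n; apply: (le_lt_trans (modulus_le_ReIm _)) => /=.
  rewrite [ltRHS]splitr ltrD// distrC; near: n.
    by move/cvgrPdist_lt : cc; apply.
  by move/cvgrPdist_lt : cs; apply.
have cx : exp_sum n x @[n --> \oo] --> cexp x.
  rewrite /x /cexp /= cos0 sin0 mulr1 mulr0.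
  under eq_fun do rewrite exp_sum_real.
  have cr := @cvg_exp_sumR (complex.Re z).
  apply/cvg_modulusP => e e0; near=> n; rewrite -rmorphB/= modulusR distrC.
  by near: n; move/cvgrPdist_lt : cr; apply.
have cd : exp_sum n x * exp_sum n w - exp_sum n z @[n --> \oo] --> (0 : C).
  apply/cvg_modulusP => e e0.
  have : exp_sum n (modulus x) * exp_sum n (modulus w) -
      exp_sum n (modulus x + modulus w) @[n --> \oo] --> (0 : R).
    rewrite -(subrr (expR (modulus x + modulus w))) {1}expRD.
    exact: cvgB (cvgM (@cvg_exp_sumR _) (@cvg_exp_sumR _)) (@cvg_exp_sumR _).
  move=> /cvgrPdist_lt/(_ _ e0); apply: filterS => n.
  rewrite sub0r normrN subr0 => h.
  rewrite zE; apply: (le_lt_trans (modulus_exp_sumM _ _ _)).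
  exact: le_lt_trans (ler_norm _) h.
have : exp_sum n x * exp_sum n w - (exp_sum n x * exp_sum n w - exp_sum n z)
    @[n --> \oo] --> cexp x * cexp w - 0 by exact: cvgB (cvgM cx cw) cd.
by rewrite subr0 -cexpD -zE; under eq_fun do rewrite subKr.
Unshelve. all: by end_near. Qed.

(** The bound does not depend on [z], so that the exponential series converges
    uniformly on discs, as convergence in the sup norm requires. *)
Lemma modulus_cexpB n z M : modulus z <= M ->
  modulus (cexp z - exp_sum n z) <= expR M - exp_sum n M.
Proof.
move=> zM; apply/ler_addgt0Pr => e e0.
have /cvg_modulusP/(_ _ e0)[N _ hN] := @cvg_exp_sum z.
have /= hm := hN (maxn N n) (leq_maxl _ _).
apply: (le_trans (modulusBB _ (exp_sum (maxn N n) z) _)); rewrite addrC lerD//.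
  apply: (le_trans (modulus_exp_sumB zM (leq_maxr _ _))).
  by rewrite lerD2r exp_sum_le_expR// (le_trans (modulus_ge0 z)).
by rewrite modulus_distC ltW.
Qed.

Lemma expR_sub1_le t : 0 <= t -> t <= 2^-1 -> expR t - 1 - t <= 2 * t ^+ 2.
Proof.
move=> t0 t1; have h := expR_ge1Dx (- t); have e0 := expR_gt0 t.
have : (1 - t) * expR t <= 1.
  by rewrite -(ler_pM2r e0) in h; rewrite (le_trans h)// -expRD addNr expR0.
move=> {}h; have : (1 - t) * expR t <= (1 - t) * (1 + t + 2 * t ^+ 2).
  rewrite (le_trans h)//.
  have -> : (1 - t) * (1 + t + 2 * t ^+ 2) = 1 + t ^+ 2 * (1 - 2 * t) by ring.
  by rewrite lerDl mulr_ge0 ?sqr_ge0// subr_ge0; lra.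
by rewrite ler_pM2l; lra.
Qed.

Lemma modulus_cexp_sub1 z : modulus z <= 2^-1 ->
  modulus (cexp z - 1 - z) <= 2 * modulus z ^+ 2.
Proof.
move=> zh; have := modulus_cexpB 2 (lexx (modulus z)).
rewrite /exp_sum !big_ord_recr !big_ord0/= !add0r !expr0 !expr1 !invr1 !mul1r !opprD !addrA.
by move=> /le_trans; apply; exact: expR_sub1_le (modulus_ge0 _) zh.
Qed.

(** The functional equation reduces differentiability to the origin. *)
Lemma derivable_cexp z : derivable cexp z 1.
Proof.
apply/derivable_modulusP; exists (cexp z) => e e0.
pose r := Num.min 2^-1 (e / (2 * modulus (cexp z))).
have m0 : 0 < modulus (cexp z) by rewrite modulus_gt0 cexp_neq0.
have r0 : 0 < r by rewrite lt_min invr_gt0 ltr0n divr_gt0// mulr_gt0.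
exists r => // w; rewrite lt_min => /andP[/ltW w1 w2].
rewrite -{1}(subrK z w) cexpD.
have -> : cexp (w - z) * cexp z - cexp z - cexp z * (w - z) =
  cexp z * (cexp (w - z) - 1 - (w - z)) by ring.
rewrite modulusM; apply: (@le_trans _ _ (modulus (cexp z) * (2 * modulus (w - z) ^+ 2))).
  by rewrite ler_pM2l//; exact: modulus_cexp_sub1.
rewrite expr2 !mulrA ler_wpM2r ?modulus_ge0//.
by move: w2; rewrite ltr_pdivlMr ?mulr_gt0// => /ltW; rewrite mulrC (mulrC 2).
Qed.

(** The principal logarithm, on the right half-plane only. *)
Definition clog z : C :=
  Complex (ln (modulus z)) (atan (complex.Im z / complex.Re z)).

Lemma clogK z : 0 < complex.Re z -> cexp (clog z) = z.
Proof.
case: z => x y /= x0; set t := y / x.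
have x0' : x != 0 by rewrite gt_eqF.
have z0 : Complex x y != 0 :> C by rewrite eq_complex/= negb_and x0'.
have yE : y = x * t by rewrite /t mulrCA divff// mulr1.
have mE : modulus (Complex x y : C) = x * Num.sqrt (1 + t ^+ 2).
  rewrite /modulus /Cplx normc_def /= yE exprMn -[X in X + _]mulr1 -mulrDr.
  by rewrite sqrtrM ?sqr_ge0// sqrtr_sqr ger0_norm// ltW.
have s0 : 0 < Num.sqrt (1 + t ^+ 2).
  by rewrite sqrtr_gt0 ltr_pwDl// sqr_ge0.
have ct : cos (atan t) = (Num.sqrt (1 + t ^+ 2))^-1 := cos_atan t.
have ct0 : cos (atan t) != 0 by rewrite ct invr_eq0 gt_eqF.
have st : sin (atan t) = t * cos (atan t).
  by rewrite -{2}(atanK t) /tan mulfVK.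
rewrite /clog/= -/t cexpE lnK ?posrE ?modulus_gt0// st ct mE.
have s0' : Num.sqrt (1 + t ^+ 2) != 0 by rewrite gt_eqF.
apply/eqP; rewrite eq_complex/= !simp0 (mulfK s0') eqxx/=.
by rewrite mulrCA (mulfK s0') mulrC -yE.
Qed.

Lemma continuous_clog z : 0 < complex.Re z -> {for z, continuous clog}.
Proof.
move=> x0; have z0 : z != 0 by apply: contraTneq x0 => ->; rewrite ltxx.
apply: continuous_ReIm.
  apply: (continuous_comp (@continuous_modulus R z)).
  by apply: continuous_ln; rewrite modulus_gt0.
apply: (@continuous_comp _ _ _ (fun z => complex.Im z / complex.Re z) (@atan R)).
  apply: continuousM; first exact: continuous_Im.
  by apply: continuousV; [rewrite gt_eqF|exact: continuous_Re].
exact: continuous_atan.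
Qed.

(** An inverse function argument: the increment [h] of [clog] satisfies
    [w - z = z * (cexp h - 1)], and [cexp h - 1] is [h] up to second order. *)
Lemma derivable_clog z : 0 < complex.Re z -> derivable clog z 1.
Proof.
move=> x0; have z0 : z != 0 by apply: contraTneq x0 => ->; rewrite ltxx.
have mz : 0 < modulus z by rewrite modulus_gt0.
apply/derivable_modulusP; exists z^-1 => e e0.
pose b := Num.min (4^-1) (e * modulus z / 4).
have b0 : 0 < b by rewrite lt_min invr_gt0 ltr0n divr_gt0 ?mulr_gt0.
have /continuous_modulusP/(_ _ b0)[r1 r10 hr1] := continuous_clog x0.
have [r2 r20 hr2] : exists2 r : R, 0 < r & forall w, modulus (w - z) < r -> 0 < complex.Re w.
  by exists (complex.Re z) => // w; exact: Re_gt0_near.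
exists (Num.min r1 r2); first by rewrite lt_min r10.
move=> w; rewrite lt_min => /andP[/hr1 w1 /hr2 w2].
set h := clog w - clog z in w1 *.
have hE : w - z = z * (cexp h - 1).
  by rewrite /h cexpD cexpN !clogK// mulrBr mulrCA divff// !mulr1.
have h14 : modulus h <= 4^-1 by move: w1; rewrite lt_min => /andP[/ltW].
have he : modulus h <= e * modulus z / 4 by move: w1; rewrite lt_min => /andP[_ /ltW].
have m0 := modulus_ge0 h.
have hh := modulus_cexp_sub1 (le_trans h14 (_ : 4^-1 <= 2^-1)).
have {}hh : modulus (cexp h - 1 - h) <= 2 * modulus h ^+ 2 by apply: hh; lra.
have hlow : modulus h <= 2 * modulus (cexp h - 1).
  have := modulusBB h (cexp h - 1) 0; rewrite !subr0 modulus_distC => h1.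
  have : 2 * modulus h ^+ 2 <= modulus h / 2.
    by rewrite expr2 mulrCA ler_wpM2l//; lra.
  by lra.
have -> : h - z^-1 * (w - z) = - (cexp h - 1 - h) by rewrite hE mulKf// [RHS]opprB.
rewrite modulusN (le_trans hh)// hE modulusM.
apply: (@le_trans _ _ (2 * (e * modulus z / 4) * (2 * modulus (cexp h - 1)))).
  by rewrite expr2 -mulrA ler_wpM2l// ler_pM.
by rewrite le_eqVlt; apply/orP; left; apply/eqP; field.
Qed.

(** Multiplication by a power of ['i] brings every nonzero number into the
    right half-plane. *)
Lemma cexp_onto w : w != 0 -> exists z, cexp z = w.
Proof.
have quarter : cexp (Complex 0 (pi / 2)) = 'i%C.
  by rewrite /cexp/= expR0 cos_pihalf sin_pihalf !mul1r.
have rotate u : (exists z, cexp z = 'i%C * u) -> exists z, cexp z = u.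
  move=> [z zu]; exists (z - Complex 0 (pi / 2)); rewrite cexpD cexpN zu quarter.
  by rewrite mulrAC divff ?mul1r// -quarter cexp_neq0.
have right u : 0 < complex.Re u -> exists z, cexp z = u.
  by move=> /clogK <-; exists (clog u).
case: w => x y w0; have [x0|x0|x0] := ltgtP x 0.
- apply/rotate/rotate/right.
  by rewrite /= !simp0 oppr_gt0.
- exact: right.
have y0 : y != 0 by move: w0; rewrite eq_complex/= x0 eqxx.
have [y1|y1|y1] := ltgtP y 0.
- by apply/rotate/right; rewrite /= !simp0 oppr_gt0.
- apply/rotate/rotate/rotate/right.
  by rewrite /= !(simp0, opprK).
- by rewrite y1 eqxx in y0.
Qed.

End ComplexExponential.

(** * Means over circles *)

Section CircleMeans.
Variable R : realType.
Local Notation C := (Cplx R).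
Implicit Types (u v f : C -> C) (z w a : C) (r s e t : R).

Lemma derivable_comp f u z :
  derivable f z 1 -> derivable u (f z) 1 -> derivable (u \o f) z 1.
Proof.
move=> /derivable1_diffP df /derivable1_diffP du.
by have /derivable1_diffP := differentiable_comp df du.
Qed.

Definition circle_pt r t : C := r%:C%C * cexp (Complex 0 t).

Lemma modulus_circle_pt r t : 0 <= r -> modulus (circle_pt r t) = r.
Proof. by move=> r0; rewrite modulusM modulusR modulus_cexp/= expR0 mulr1 ger0_norm. Qed.

Lemma cexp_ln r t : 0 < r -> cexp (Complex (ln r) t) = circle_pt r t.
Proof.
by move=> r0; rewrite cexpE lnK ?posrE// /circle_pt cexpE expR0 mul1r.
Qed.

Lemma continuous_circle_pt r : continuous (circle_pt r).
Proof.
move=> t; have ct : {for t, continuous (fun t => Complex 0 t : C)}.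
  by apply: continuous_ReIm; [exact: cst_continuous|exact: cvg_id].
have ce := continuous_comp ct (derivable_continuous (@derivable_cexp R (Complex 0 t))).
exact: (continuousM (@cst_continuous _ _ (r%:C%C : C) t) ce).
Qed.

Definition twopi : R := pi *+ 2.

Lemma twopi_gt0 : 0 < twopi.
Proof. by rewrite /twopi mulrn_wgt0// pi_gt0. Qed.

Definition mean r u : C := (twopi^-1)%:C%C * Cint 0 twopi (u \o circle_pt r).

Definition cont_circle r u := forall z, modulus z = r -> {for z, continuous u}.

Lemma cont_circleP r u : 0 <= r -> cont_circle r u ->
  cont_on 0 twopi (u \o circle_pt r).
Proof.
move=> r0 cu t _; apply: (continuous_comp (@continuous_circle_pt r t)).
by apply: cu; rewrite modulus_circle_pt.
Qed.

Lemma cont_circleM r u v : cont_circle r u -> cont_circle r v ->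
  cont_circle r (fun z => u z * v z).
Proof. by move=> cu cv z zr; exact: (continuousM (cu z zr) (cv z zr)). Qed.

Lemma cont_circleB r u v : cont_circle r u -> cont_circle r v ->
  cont_circle r (fun z => u z - v z).
Proof. by move=> cu cv z zr; exact: (continuousB (cu z zr) (cv z zr)). Qed.

Lemma cont_circle_cst r a : cont_circle r (fun=> a).
Proof. by move=> z _; exact: cst_continuous. Qed.

Lemma eq_mean r u v : 0 <= r -> (forall z, modulus z = r -> u z = v z) ->
  mean r u = mean r v.
Proof.
move=> r0 uv; congr (_ * _); apply: eq_Cint => t _ /=.
by apply: uv; rewrite modulus_circle_pt.
Qed.

Lemma meanD r u v : 0 <= r -> cont_circle r u -> cont_circle r v ->
  mean r (fun z => u z + v z) = mean r u + mean r v.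
Proof.
move=> r0 cu cv; rewrite /mean -mulrDr -CintD//.
  exact: cont_circleP cu.
exact: cont_circleP cv.
Qed.

Lemma meanZ r a u : 0 <= r -> cont_circle r u ->
  mean r (fun z => a * u z) = a * mean r u.
Proof.
move=> r0 cu; rewrite /mean mulrCA -(CintZ a (cont_circleP r0 cu)).
by [].
Qed.

Lemma meanB r u v : 0 <= r -> cont_circle r u -> cont_circle r v ->
  mean r (fun z => u z - v z) = mean r u - mean r v.
Proof.
move=> r0 cu cv; rewrite /mean -mulrBr -CintB//.
  exact: cont_circleP cu.
exact: cont_circleP cv.
Qed.

Lemma mean_cst r a : mean r (fun=> a) = a.
Proof.
have t0 := twopi_gt0.
rewrite /mean (_ : _ \o _ = fun=> a)//.
rewrite Cint_cst ?ltW// subr0 mulrA -rmorphM/= mulVf ?gt_eqF//.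
by rewrite mul1r.
Qed.

Lemma mean_le r u (K : R) : 0 <= r -> cont_circle r u ->
  (forall z, modulus z = r -> modulus (u z) <= K) -> modulus (mean r u) <= 2 * K.
Proof.
move=> r0 cu uK; have t0 := twopi_gt0; have ti : 0 <= twopi^-1 by rewrite invr_ge0 ltW.
rewrite /mean modulusM modulusR (ger0_norm ti) ler_pdivrMl// mulrC.
have := Cint_le (ltW t0) (cont_circleP r0 cu) (K := K).
rewrite subr0; apply=> t _.
by apply: uK; rewrite modulus_circle_pt.
Qed.

Lemma Re_mean_le r u (K : R) : 0 <= r -> cont_circle r u ->
  (forall z, modulus z = r -> complex.Re (u z) <= K) -> complex.Re (mean r u) <= K.
Proof.
move=> r0 cu uK; have t0 := twopi_gt0.
have KE : twopi * K = \int[@lebesgue_measure R]_(x in `[0, twopi]) K.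
  by rewrite Rintegral_cst// (length_itvcc (ltW t0)) subr0 mulrC.
rewrite /mean /= mul0r subr0 ler_pdivrMl// KE.
apply: le_Rintegral => //.
- exact: integrable_Re (cont_circleP r0 cu).
- apply: continuous_compact_integrable; first exact: segment_compact.
  by apply: continuous_subspaceT => x; exact: cst_continuous.
- by move=> t _ /=; apply: uK; rewrite modulus_circle_pt.
Qed.

(** Cauchy's theorem for an annulus: in the coordinate [w] with [z = cexp w]
    the annulus is a rectangle, whose two horizontal sides cancel by
    periodicity of [cexp]. *)
Lemma mean_annulus r s u : 0 < r -> r <= s ->
  (forall z, r <= modulus z <= s -> derivable u z 1) -> mean r u = mean s u.
Proof.
move=> r0 rs hu; have s0 := lt_le_trans r0 rs; have t0 := twopi_gt0.
have lrs : ln r <= ln s by rewrite ler_ln// posrE.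
pose G := u \o @cexp R.
have hG : hol_rect G (ln r) (ln s) 0 twopi.
  move=> x y /andP[rx xs] _; apply: derivable_comp; first exact: derivable_cexp.
  apply: hu; rewrite modulus_cexp/=.
  by rewrite -(@lnK _ r) ?posrE// -(@lnK _ s) ?posrE// !ler_expR rx.
have := goursat lrs (ltW t0) hG; rewrite /rect_int.
rewrite (_ : Cint (ln r) _ _ = 0); last first.
  rewrite (@eq_Cint _ _ _ _ (fun=> 0)) ?Cint_cst ?mulr0// => x _.
  by rewrite /G/= !cexpE /twopi cos2pi sin2pi cos0 sin0 subrr.
have circ q : 0 < q -> (fun y => G (Complex (ln q) y)) = u \o circle_pt q.
  by move=> q0; apply/funext => y; rewrite /G/= cexp_ln.
have rr : ln r <= ln r <= ln s by rewrite lexx.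
have ss : ln r <= ln s <= ln s by rewrite lexx andbT.
rewrite (CintB (cont_on_ver hG ss) (cont_on_ver hG rr)) !circ// add0r.
move/eqP; rewrite mulf_eq0 subr_eq0 => /orP[/eqP i0|/eqP E].
  by have := modulusi R; rewrite i0 modulus0 => /eqP; rewrite eq_sym oner_eq0.
by rewrite /mean E.
Qed.

End CircleMeans.

(** * Cauchy's formula and polynomial approximation *)

Section CauchyFormula.
Variable R : realType.
Local Notation C := (Cplx R).
Implicit Types (u v f : C -> C) (z w a : C) (r s e t : R).

Lemma compact_disc r : r <= 1 -> compact [set z : C | modulus z <= r].
Proof.
move=> r1; apply: (subclosed_compact _ (@compact_closed_disc R)).
  rewrite (_ : [set _ | _] = @modulus R @^-1` [set x | x <= r])//.
  by apply: closed_comp; [move=> z _; exact: continuous_modulus|exact: closed_le].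
by move=> z /= zr; rewrite /closed_disc/= ler_modulus1 (le_trans zr).
Qed.

Lemma heine (K : set C) u : compact K ->
  (forall z, K z -> forall e, 0 < e -> exists2 d, 0 < d &
    forall w, K w -> modulus (w - z) < d -> modulus (u w - u z) < e) ->
  forall e, 0 < e -> exists2 d, 0 < d &
    forall z w, K z -> K w -> modulus (z - w) < d -> modulus (u z - u w) < e.
Proof.
move=> /compact_near_coveringP cK cu e e0.
pose P d z := forall w, K z -> K w -> modulus (z - w) < d -> modulus (u z - u w) < e.
have e20 : 0 < e / 2 by rewrite divr_gt0.
have : \forall d \near (0 : R)^'+, K `<=` P d.
  apply: (cK _ _ P) => z Kz; have [d d0 hd] := cu _ Kz _ e20.
  have d20 : 0 < d / 2 by rewrite divr_gt0.
  exists ([set w | modulus (w - z) < d / 2], [set x : R | x < d / 2]) => /=.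
    split; first by apply/near_modulusP; exists (d / 2).
    exact: nbhs_right_lt.
  move=> [w x] /= [wz xd] y Kw Ky wy; rewrite [ltRHS]splitr.
  apply: (le_lt_trans (modulusBB _ (u z) _)); rewrite ltrD//.
    by apply: hd => //; rewrite (lt_trans wz)// gtr_pMr// invf_lt1// ltr1n.
  rewrite modulus_distC; apply: hd => //; rewrite [ltRHS]splitr.
  apply: (le_lt_trans (modulusBB _ w _)); rewrite ltrD//.
  by rewrite modulus_distC (lt_trans wy).
move=> near0; near (0 : R)^'+ => d; exists d => // z w Kz Kw.
have : K `<=` P d by near: d.
by move=> /(_ z Kz); exact.
Unshelve. all: by end_near. Qed.

Lemma derivable_sub_cst f a z : derivable f z 1 -> derivable (fun z => f z - a) z 1.
Proof. by move=> df; exact: (derivableB df (derivable_cst a z 1)). Qed.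

Lemma derivable_inv_sub a z : z != a -> derivable (fun z => (z - a)^-1) z 1.
Proof.
rewrite -subr_eq0 => za.
have ds : derivable (fun z => z - a) z 1.
  exact: (@derivable_sub_cst id a z (@derivable_id _ _ z 1)).
exact: (@derivableV _ _ (fun z => z - a) z 1 za ds).
Qed.

Lemma derivable_kernel a z : z != a -> derivable (fun z => z / (z - a)) z 1.
Proof. by move=> za; exact: (@derivableM _ _ id (fun z => (z - a)^-1) z 1 (@derivable_id _ _ z 1) (derivable_inv_sub za)). Qed.

Lemma derivable_quotient f a z : derivable f z 1 -> z != a ->
  derivable (fun z => (f z - f a) / (z - a)) z 1.
Proof.
move=> df za.
exact: (derivableM (@derivable_sub_cst f (f a) z df) (derivable_inv_sub za)).
Qed.

(** Differentiability at [a] of the extended quotient is out of reach before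
    Cauchy's formula, so that the next lemma can ask for continuity only. *)
Lemma continuous_quotient f a : derivable f a 1 -> exists d : C,
  {for a, continuous (fun z => if z == a then d else (f z - f a) / (z - a))}.
Proof.
move=> /derivable_modulusP[d hd]; exists d; apply/continuous_modulusP => e e0.
have e20 : 0 < e / 2 by rewrite divr_gt0.
have [r r0 hr] := hd _ e20; exists r => // w wr; rewrite eqxx.
have [_|wa] := eqVneq w a; first by rewrite subrr modulus0.
have wa0 : w - a != 0 by rewrite subr_eq0.
have mwa : 0 < modulus (w - a) by rewrite modulus_gt0.
have -> : (f w - f a) / (w - a) - d = (f w - f a - d * (w - a)) / (w - a).
  by rewrite [RHS]mulrBl mulfK.
rewrite modulusM modulusV ltr_pdivrMr// (le_lt_trans (hr _ wr))// ltr_pM2r//.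
by rewrite gtr_pMr// invf_lt1// ltr1n.
Qed.

Lemma near_neq z a : z != a -> \forall w \near z, w != a.
Proof.
move=> za; apply/near_modulusP; exists (modulus (z - a)).
  by rewrite modulus_gt0 subr_eq0.
by move=> w; apply: contraTneq => ->; rewrite modulus_distC ltxx.
Qed.

(** By Cauchy's theorem the mean is a constant function of the radius on each
    side of the circle through [a]; it is continuous across that circle, and
    small on small circles because of the factor [z]. *)
Lemma mean_mul_quotient q a r : modulus a < r -> r < 1 ->
  (forall z, modulus z <= r -> {for z, continuous q}) ->
  (forall z, modulus z <= r -> z != a -> derivable q z 1) ->
  mean r (fun z => z * q z) = 0.
Proof.
move=> ar r1 cq dq; set v := fun z => z * q z.
have r0 : 0 < r := le_lt_trans (modulus_ge0 _) ar.
have cv z : modulus z <= r -> {for z, continuous v}.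
  by move=> zr; exact: (continuousM (@cvg_id _ (nbhs z)) (cq z zr)).
have dv z : modulus z <= r -> z != a -> derivable v z 1.
  by move=> zr za; exact: (derivableM (@derivable_id _ _ z 1) (dq z zr za)).
have cc s : s <= r -> cont_circle s v by move=> sr z zs; apply: cv; rewrite zs.
apply/eqP; rewrite -modulus_eq0 eq_le modulus_ge0 andbT.
apply/ler_addgt0Pr => e e0; rewrite add0r.
have e40 : 0 < e / 4 by rewrite divr_gt0.
have [d d0 hd] : exists2 d, 0 < d & forall z w, modulus z <= r -> modulus w <= r ->
    modulus (z - w) < d -> modulus (v z - v w) < e / 4.
  apply: (heine (compact_disc (ltW r1))) => // z zr e' e'0.
  by have /continuous_modulusP/(_ _ e'0)[d d0 hd] := cv z zr; exists d => // w _ /hd.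
have small s : 0 < s -> s < d -> s <= r -> modulus (mean s v) <= e / 2.
  move=> s0 sd sr; have -> : e / 2 = 2 * (e / 4) by field.
  apply: mean_le; [exact: ltW|exact: cc|move=> z zs].
  have := hd z 0; rewrite zs modulus0 (ltW r0) subr0 zs => /(_ sr isT sd).
  by rewrite /v mul0r subr0 => /ltW.
(* for [a = 0] there is no circle to cross *)
have [a0|a0] := eqVneq a 0.
  pose s := Num.min r (d / 2).
  have s0 : 0 < s by rewrite lt_min r0 divr_gt0.
  have sr : s <= r by rewrite ge_min lexx.
  have sd : s < d.
    by rewrite gt_min; apply/orP; right; rewrite gtr_pMr// invf_lt1// ltr1n.
  rewrite -(mean_annulus s0 sr) ?(le_trans (small _ s0 sd sr))//; last first.
    move=> z /andP[sz zr]; apply: dv => //; rewrite a0 -modulus_gt0.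
    exact: lt_le_trans sz.
  by rewrite ler_pdivrMr// ler_peMr ?ler1n// ltW.
have ma : 0 < modulus a by rewrite modulus_gt0.
(* the radii [s1] and [s2] lie on both sides of [modulus a], at distance [h] *)
pose h := Num.min (modulus a / 2) (Num.min (r - modulus a) (d / 3)).
have h0 : 0 < h by rewrite !lt_min !divr_gt0//= subr_gt0 ar.
have ha : h < modulus a.
  by rewrite gt_min gtr_pMr// invf_lt1// ltr1n.
have hr : h <= r - modulus a by rewrite !ge_min lexx orbT.
have hd3 : h <= d / 3 by rewrite !ge_min lexx !orbT.
have [s1 s1E] : exists s1, s1 = modulus a - h by eexists.
have [s2 s2E] : exists s2, s2 = modulus a + h by eexists.
have s10 : 0 < s1 by rewrite s1E subr_gt0.
have s2r : s2 <= r by rewrite s2E addrC -lerBrDr.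
have s1r : s1 <= r by rewrite (le_trans _ s2r)// s1E s2E; lra.
pose s := Num.min s1 (d / 2).
have s0 : 0 < s by rewrite lt_min s10 divr_gt0.
have ss1 : s <= s1 by rewrite ge_min lexx.
have sd : s < d.
  by rewrite gt_min; apply/orP; right; rewrite gtr_pMr// invf_lt1// ltr1n.
have E1 : mean s v = mean s1 v.
  apply: mean_annulus => // z /andP[_ zs1]; apply: dv; first exact: le_trans s1r.
  by apply: contraTneq zs1 => ->; rewrite -ltNge s1E; lra.
have E2 : mean s2 v = mean r v.
  apply: mean_annulus => //; first by rewrite s2E addr_gt0.
  move=> z /andP[zs2 zr]; apply: dv => //.
  by apply: contraTneq zs2 => ->; rewrite -ltNge s2E; lra.
have E3 : modulus (mean s2 v - mean s1 v) <= e / 2.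
  have -> : e / 2 = 2 * (e / 4) by field.
  have s20 : 0 < s2 by rewrite s2E addr_gt0.
  have -> : mean s2 v - mean s1 v =
      ((twopi R)^-1)%:C%C * Cint 0 (twopi R) (fun t => v (circle_pt s2 t) - v (circle_pt s1 t)).
    rewrite (CintB (cont_circleP (ltW s20) (cc _ s2r)) (cont_circleP (ltW s10) (cc _ s1r))).
    by rewrite mulrBr.
  have t0 := twopi_gt0 R; have ti : 0 <= (twopi R)^-1 by rewrite invr_ge0 ltW.
  rewrite modulusM modulusR (ger0_norm ti) ler_pdivrMl// mulrC.
  have := Cint_le (ltW t0) (cont_onB (cont_circleP (ltW s20) (cc _ s2r)) (cont_circleP (ltW s10) (cc _ s1r))) (K := e / 4).
  have m1 t : modulus (circle_pt s1 t) <= r by rewrite (modulus_circle_pt _ (ltW s10)).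
  have m2 t : modulus (circle_pt s2 t) <= r by rewrite (modulus_circle_pt _ (ltW s20)).
  rewrite subr0; apply=> t _; apply: ltW; apply: (hd _ _ (m2 t) (m1 t)).
  rewrite /circle_pt -mulrBl -rmorphB/= modulusM modulusR modulus_cexp/= expR0 mulr1.
  have -> : s2 - s1 = 2 * h by rewrite s2E s1E; ring.
  have h20 : 0 <= 2 * h by rewrite mulr_ge0// ltW.
  by rewrite (ger0_norm h20); clear -hd3 h0 d0; lra.
rewrite -E2 -(subrK (mean s1 v) (mean s2 v)); apply: (le_trans (modulusD _ _)).
rewrite [e]splitr; apply: lerD; first exact: E3.
by rewrite -E1; exact: (small _ s0 sd (le_trans ss1 s1r)).
Qed.

(** The mean does not change when the radius grows to infinity, where the
    integrand tends to [1]. *)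
Lemma mean_kernel a r : modulus a < r -> mean r (fun z => z / (z - a)) = 1.
Proof.
move=> ar; have r0 : 0 < r := le_lt_trans (modulus_ge0 _) ar.
have za z : r <= modulus z -> z != a.
  by move=> rz; apply: contraTneq ar => <-; rewrite -leNgt.
have dk z : r <= modulus z -> derivable (fun z => z / (z - a)) z 1.
  by move=> /za; exact: derivable_kernel.
have ck s : r <= s -> cont_circle s (fun z => z / (z - a)).
  by move=> rs z zs; apply/derivable_continuous/dk; rewrite zs.
apply/eqP; rewrite -subr_eq0 -modulus_eq0 eq_le modulus_ge0 andbT.
apply/ler_addgt0Pr => e e0; rewrite add0r.
(* on the circle of radius [s] the integrand is within [e / 2] of [1] *)
pose s := r + 2 * modulus a / e.
have rs : r <= s by rewrite lerDl divr_ge0 ?mulr_ge0 ?modulus_ge0// ltW.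
have s0 := lt_le_trans r0 rs.
have sa : 0 < s - modulus a by rewrite subr_gt0 (lt_le_trans ar).
rewrite (mean_annulus r0 rs); last by move=> z /andP[rz _]; exact: dk.
rewrite -{1}(mean_cst s 1) -(meanB (ltW s0) (ck _ rs)); last exact: cont_circle_cst.
have -> : e = 2 * (e / 2) by field.
apply: mean_le; first exact: ltW.
  exact: (cont_circleB (ck _ rs) (@cont_circle_cst _ _ 1)).
move=> z zs; have z0 : z - a != 0 by rewrite subr_eq0 za// zs.
have -> : z / (z - a) - 1 = a / (z - a) by field.
have zaa : s - modulus a <= modulus (z - a).
  by rewrite lerBlDr -zs -{1}(subrK a z) modulusD.
rewrite modulusM modulusV ler_pdivrMr ?modulus_gt0//.
apply: (@le_trans _ _ (e / 2 * (s - modulus a))); last by rewrite ler_pM2l ?divr_gt0.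
have -> : e / 2 * (s - modulus a) = e / 2 * (r - modulus a) + modulus a.
  by rewrite /s; field; rewrite gt_eqF.
by rewrite lerDr mulr_ge0 ?divr_ge0 ?ltW// subr_gt0.
Qed.

(** The difference quotient of [f] at [a] times [z] has mean [0], and the
    kernel [z / (z - a)] has mean [1]. *)
Theorem cauchy_formula f a r : modulus a < r -> r < 1 ->
  (forall z, modulus z < 1 -> derivable f z 1) ->
  mean r (fun z => f z * (z / (z - a))) = f a.
Proof.
move=> ar r1 df; have r0 : 0 < r := le_lt_trans (modulus_ge0 _) ar.
have [d cd] := continuous_quotient (df a (lt_trans ar r1)).
pose q z := if z == a then d else (f z - f a) / (z - a).
have qE z : z != a -> \forall w \near z, (f w - f a) / (w - a) = q w.
  by move=> za; apply: filterS (near_neq za) => w wa; rewrite /q (negbTE wa).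
have dq z : modulus z <= r -> z != a -> derivable q z 1.
  move=> zr za.
  exact: (near_eq_derivable (qE z za) (derivable_quotient (df z (le_lt_trans zr r1)) za)).
have cq z : modulus z <= r -> {for z, continuous q}.
  move=> zr; have [->|za] := eqVneq z a; first exact: cd.
  exact: derivable_continuous (dq z zr za).
have := mean_mul_quotient ar r1 cq dq.
have cf : cont_circle r f.
  by move=> z zr; apply/derivable_continuous/df; rewrite zr.
have ck : cont_circle r (fun z => z / (z - a)).
  move=> z zr; apply/derivable_continuous/derivable_kernel.
  by apply: contraTneq ar => <-; rewrite -leNgt zr.
rewrite (@eq_mean _ _ _ (fun z => f z * (z / (z - a)) - f a * (z / (z - a)))) ?ltW//.
  rewrite (meanB (ltW r0) (cont_circleM cf ck) (cont_circleM (@cont_circle_cst _ _ (f a)) ck)).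
  by rewrite (meanZ _ (ltW r0) ck) mean_kernel// mulr1 => /eqP; rewrite subr_eq0 => /eqP.
move=> z zr; have za : z != a by apply: contraTneq ar => <-; rewrite -leNgt zr.
by rewrite /q (negbTE za); field; rewrite subr_eq0.
Qed.

(** Expanding the Cauchy kernel into a geometric sum turns the formula into
    polynomial approximation, uniformly on each smaller disc. *)
Theorem holomorphic_poly_approx f r e : 0 < r -> r < 1 -> 0 < e ->
  (forall z, modulus z < 1 -> derivable f z 1) ->
  exists p : {poly C}, forall a, modulus a <= r -> modulus (f a - p.[a]) <= e.
Proof.
move=> r0 r1 e0 df.
have [s [rs s1]] : exists s, r < s /\ s < 1 by exists ((r + 1) / 2); split; lra.
have s0 := lt_trans r0 rs.
have [K K0 hK] : exists2 K : R, 0 < K & forall z, modulus z = s -> modulus (f z) <= K.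
  have : compact (@modulus R @` (f @` [set z : C | modulus z <= s])).
    apply: continuous_compact.
      by apply: continuous_subspaceT; exact: continuous_modulus.
    apply: continuous_compact (compact_disc (ltW s1)).
    apply: continuous_in_subspaceT => z; rewrite inE/= => zs.
    by apply/derivable_continuous/df/(le_lt_trans zs).
  move=> /compact_bounded[M [_ hM]]; exists (`|M| + 1); first by rewrite ltr_wpDl.
  move=> z zs; apply: le_trans (ler_norm _) _; apply: hM.
    by rewrite (le_lt_trans (ler_norm M))// ltrDl.
  by exists (f z) => //; exists z => //=; rewrite zs.
have [N hN] : exists N, 2 * (K * (s / (s - r))) * (r / s) ^+ N < e.
  have : geometric (2 * (K * (s / (s - r)))) (r / s) @ \oo --> (0 : R).
    have q0 : 0 <= r / s by rewrite divr_ge0// ltW.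
    by apply: cvg_geometric; rewrite (ger0_norm q0) ltr_pdivrMr// mul1r.
  move=> /cvgrPdist_lt/(_ _ e0)[N _ hN]; exists N.
  by have := hN N (leqnn N); rewrite /= sub0r normrN; apply: le_lt_trans; exact: ler_norm.
have zn0 z : modulus z = s -> z != 0 by move=> zs; rewrite -modulus_gt0 zs.
have cf : cont_circle s f.
  by move=> z zs; apply/derivable_continuous/df; rewrite zs.
have cV : cont_circle s (fun z => z^-1).
  by move=> z zs; exact: (continuousV (zn0 z zs) (@cvg_id _ (nbhs z))).
have cVX n : cont_circle s (fun z => z^-1 ^+ n).
  elim: n => [|n IH]; first exact: cont_circle_cst.
  by under eq_fun do rewrite exprS; exact: (cont_circleM cV IH).
exists (\poly_(n < N) mean s (fun z => f z * z^-1 ^+ n)) => a ar.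
have as_ := le_lt_trans ar rs.
have za z : modulus z = s -> z - a != 0.
  by move=> zs; rewrite subr_eq0; apply: contraTneq as_ => <-; rewrite -leNgt zs.
have ck : cont_circle s (fun z => z / (z - a)).
  by move=> z zs; apply/derivable_continuous/derivable_kernel; rewrite -subr_eq0 za.
have cg n : cont_circle s (fun z => f z * (\sum_(k < n) (a ^+ k * z^-1 ^+ k))).
  suff cS : cont_circle s (fun z => \sum_(k < n) (a ^+ k * z^-1 ^+ k)).
    exact: (cont_circleM cf cS).
  elim: n => [|n IH].
    by under eq_fun do rewrite big_ord0; exact: cont_circle_cst.
  under eq_fun do rewrite big_ord_recr/=.
  move=> z zs; have cn := cont_circleM (@cont_circle_cst _ s (a ^+ n)) (cVX n).
  exact: (continuousD (IH z zs) (cn z zs)).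
have pE n : \sum_(k < n) mean s (fun z => f z * z^-1 ^+ k) * a ^+ k =
    mean s (fun z => f z * \sum_(k < n) (a ^+ k * z^-1 ^+ k)).
  elim: n => [|n IH].
    rewrite big_ord0; under eq_fun do rewrite big_ord0 mulr0.
    by rewrite mean_cst.
  rewrite big_ord_recr/= IH mulrC -(meanZ _ (ltW s0) (cont_circleM cf (cVX n))).
  rewrite -(meanD (ltW s0) (cg n)); last first.
    exact: (cont_circleM (@cont_circle_cst _ _ (a ^+ n)) (cont_circleM cf (cVX n))).
  by apply: eq_mean => [|z _]; [exact: ltW|rewrite big_ord_recr/= mulrDr mulrCA].
rewrite horner_poly pE -{1}(cauchy_formula as_ s1 df).
rewrite -(meanB (ltW s0) (cont_circleM cf ck) (cg N)).
apply: (le_trans _ (ltW hN)); rewrite -mulrA.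
apply: mean_le; first exact: ltW.
  exact: (cont_circleB (cont_circleM cf ck) (cg N)).
move=> z zs; have z0 := zn0 z zs.
have -> : f z * (z / (z - a)) - f z * \sum_(k < N) (a ^+ k * z^-1 ^+ k) =
    f z * (z / (z - a)) * (a / z) ^+ N.
  have geo : \sum_(k < N) (a ^+ k * z^-1 ^+ k) = (1 - (a / z) ^+ N) * (z / (z - a)).
    have -> : z / (z - a) = (1 - a / z)^-1.
      by rewrite -{1}(divff z0) -mulrBl invfM invrK mulrC.
    have az0 : 1 - a / z != 0.
      by rewrite -{1}(divff z0) -mulrBl mulf_neq0 ?za ?invr_eq0.
    apply: (mulIf az0); rewrite mulfVK// mulrC -[in RHS](expr1n _ N) subrXX.
    by congr (_ * _); apply: eq_bigr => k _; rewrite expr1n mul1r exprMn.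
  by rewrite geo; ring.
rewrite !modulusM modulusX !modulusM !modulusV zs -!mulrA.
have sr0 : 0 < s - r by rewrite subr_gt0.
have ss0 : 0 <= s^-1 by rewrite invr_ge0 ltW.
have ga : s - r <= modulus (z - a).
  by rewrite lerBlDr -zs -{1}(subrK a z) (le_trans (modulusD _ _))// lerD2l.
have kz0 : 0 <= (modulus (z - a))^-1 by rewrite invr_ge0 modulus_ge0.
have rs0 : 0 <= modulus a * s^-1 by rewrite mulr_ge0 ?modulus_ge0.
have h1 : (modulus (z - a))^-1 <= (s - r)^-1 by rewrite lef_pV2 ?posrE// (lt_le_trans sr0).
have h2 : (modulus a * s^-1) ^+ N <= (r * s^-1) ^+ N.
  rewrite lerXn2r ?nnegrE// ?(mulr_ge0 (ltW r0) ss0)//.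
  by rewrite ler_wpM2r.
have h3 : s * ((modulus (z - a))^-1 * (modulus a * s^-1) ^+ N) <=
    s * ((s - r)^-1 * (r * s^-1) ^+ N).
  by rewrite ler_pM2l// ler_pM// exprn_ge0.
apply: ler_pM => //; rewrite ?modulus_ge0 ?hK//.
by apply: mulr_ge0; [exact: (ltW s0)|rewrite mulr_ge0// exprn_ge0].
Qed.

End CauchyFormula.

(** * Functions continuous on the closed disc and holomorphic inside *)

Section DiscHolomorphic.
Variable R : realType.
Local Notation C := (Cplx R).
Local Notation D := (closed_disc R).
Implicit Types (u v E : C -> C) (z w a : C) (r e t d : R) (f g : disc_alg R).

(** The plane functions that restrict to elements of the disc algebra; unlike
    these, they can be composed and dilated freely. *)
Definition disc_hol u :=
  (forall z, modulus z <= 1 -> u @ within D (nbhs z) --> u z) /\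
  (forall z, modulus z < 1 -> derivable u z 1).

Lemma within_modulusP u z (l : C) : u @ within D (nbhs z) --> l <->
  forall e, 0 < e -> exists2 d, 0 < d &
    forall w, modulus w <= 1 -> modulus (w - z) < d -> modulus (u w - l) < e.
Proof.
have wP := @cvg_modulusP R C (within D (nbhs z)) _ u l.
split=> [/wP ul e e0|ul].
  have := ul e e0; rewrite near_withinE => /near_modulusP[d d0 hd].
  by exists d => // w w1 wz; apply: hd => //; rewrite /closed_disc/= ler_modulus1.
apply/wP => e e0; rewrite near_withinE; apply/near_modulusP.
have [d d0 hd] := ul e e0; exists d => // w wz.
by rewrite /closed_disc/= ler_modulus1 => w1; exact: hd.
Qed.

Lemma disc_hol_cst a : disc_hol (fun=> a).
Proof. by split=> z _; [exact: cvg_cst|exact: derivable_cst]. Qed.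

Lemma disc_hol_id : disc_hol id.
Proof.
split=> z _; last exact: derivable_id.
by apply/within_modulusP => e e0; exists e.
Qed.

Lemma disc_holD u v : disc_hol u -> disc_hol v -> disc_hol (fun z => u z + v z).
Proof.
move=> [cu du] [cv dv]; split=> z z1.
  exact: (cvgD (cu z z1) (cv z z1)).
exact: (derivableD (du z z1) (dv z z1)).
Qed.

Lemma disc_holM u v : disc_hol u -> disc_hol v -> disc_hol (fun z => u z * v z).
Proof.
move=> [cu du] [cv dv]; split=> z z1.
  exact: (cvgM (cu z z1) (cv z z1)).
exact: (derivableM (du z z1) (dv z z1)).
Qed.

Lemma disc_holV u : (forall z, modulus z <= 1 -> u z != 0) -> disc_hol u ->
  disc_hol (fun z => (u z)^-1).
Proof.
move=> u0 [cu du]; split=> z z1; first exact: (cvgV (u0 z z1) (cu z z1)).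
exact: (derivableV (u0 z (ltW z1)) (du z z1)).
Qed.

Lemma disc_hol_sum n (u : 'I_n -> C -> C) : (forall k, disc_hol (u k)) ->
  disc_hol (fun z => \sum_(k < n) u k z).
Proof.
elim: n u => [|n IH] u hu.
  by under eq_fun do rewrite big_ord0; exact: disc_hol_cst.
under eq_fun do rewrite big_ord_recr/=.
by apply: disc_holD; [exact: IH|exact: hu].
Qed.

Lemma disc_hol_comp E u : (forall z, modulus z <= 1 -> derivable E (u z) 1) ->
  disc_hol u -> disc_hol (E \o u).
Proof.
move=> hE [cu du]; split=> z z1.
  exact: (@cvg_comp _ _ _ u E _ _ _ (cu z z1) (derivable_continuous (hE z z1))).
exact: (derivable_comp (du z z1) (hE z (ltW z1))).
Qed.

Lemma disc_hol_dilate t u : 0 <= t <= 1 -> disc_hol u -> disc_hol (fun z => u (t%:C%C * z)).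
Proof.
move=> /andP[t0 t1] [cu du].
have mt z : modulus (t%:C%C * z) <= modulus z.
  by rewrite modulusM modulusR ger0_norm// ler_piMl// modulus_ge0.
split=> z z1.
  apply/within_modulusP => e e0.
  have /within_modulusP/(_ _ e0)[d d0 hd] := cu _ (le_trans (mt z) z1).
  exists d => // w w1 wz; apply: hd; first exact: le_trans (mt w) w1.
  by rewrite -mulrBr (le_lt_trans (mt _)).
apply: (@derivable_comp _ (fun z => t%:C%C * z) u).
  exact: (@derivableM _ _ (fun=> t%:C%C) id z 1
    (derivable_cst _ z 1) (@derivable_id _ _ z 1)).
exact: (du _ (le_lt_trans (mt z) z1)).
Qed.

End DiscHolomorphic.

(** * Values, units and logarithms in the disc algebra *)

Section DiscAlgebraElements.
Variable R : realType.
Local Notation C := (Cplx R).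
Local Notation D := (closed_disc R).
Local Notation disc_alg := (disc_alg R).
Implicit Types (u v E : C -> C) (z w a : C) (r e t d : R) (f g : disc_alg).

Definition dval f : C -> C := 'valL_0 (disc_alg_val f : D -> C).

Lemma in_disc z : modulus z <= 1 -> z \in D.
Proof. by move=> z1; rewrite inE /closed_disc/= ler_modulus1. Qed.

Lemma dvalE f z (z1 : modulus z <= 1) :
  dval f z = f (SigSub (in_disc z1) : cdisc R).
Proof. by rewrite /dval (extE f (in_disc z1)). Qed.

Lemma dval_val f (x : cdisc R) : f x = dval f (val x).
Proof. by case: x => x xD; rewrite /dval (extE f xD). Qed.

Lemma modulus_cdisc (x : cdisc R) : modulus (val x) <= 1.
Proof. by case: x => x xD /=; move: (xD); rewrite inE /closed_disc/= ler_modulus1. Qed.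

Lemma disc_hol_dval f : disc_hol (dval f).
Proof.
have [cf df] := set_mem (valP f); split=> z z1; last first.
  by apply: df; move: z1; rewrite modulusE -(ltcR (modulus z) 1).
have /subspace_continuousP cf' : {within D, continuous (dval f)}.
  by apply/subspace_valL_continuousP'.
by apply: cf'; rewrite /closed_disc/= ler_modulus1.
Qed.

Lemma dvalP f g : (forall z, modulus z <= 1 -> dval f z = dval g z) -> f = g.
Proof.
move=> fg; apply/val_inj/funext => x.
by rewrite [LHS]dval_val [RHS]dval_val fg// modulus_cdisc.
Qed.

Lemma disc_alg_of u : disc_hol u ->
  exists f, forall z, modulus z <= 1 -> dval f z = u z.
Proof.
move=> [cu du]; pose f0 : cdisc R -> C := fun x => u (val x).
have f0E z : z \in D -> ('valL_0 (f0 : D -> C) : C -> C) z = u z.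
  by move=> zD; rewrite (extE f0 zD).
have f0D : f0 \in @disc_alg_pred R.
  apply/mem_set; split.
    apply/(subspace_sigL_continuousP D u)/subspace_continuousP => z.
    by rewrite /closed_disc/= ler_modulus1; exact: cu.
  move=> z z1; have mz1 : modulus z < 1.
    by move: z1; rewrite modulusE -(ltcR (modulus z) 1).
  apply: (near_eq_derivable _ (du z mz1)).
  by apply: filterS (near_closed_disc z1) => w wD; rewrite f0E.
exists (DiscAlg f0D) => z z1.
exact: f0E (in_disc z1).
Qed.

Lemma dvalD f g z : dval (f + g) z = dval f z + dval g z.
Proof. by rewrite /dval (extD f g). Qed.

Lemma dvalM f g z : dval (f * g) z = dval f z * dval g z.
Proof. by rewrite /dval (extM f g). Qed.

Lemma dvalN f z : dval (- f) z = - dval f z.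
Proof.
have dval0 : dval 0 z = 0.
  by apply: (@addrI _ (dval 0 z)); rewrite -dvalD !addr0.
by apply/eqP; rewrite -addr_eq0 -dvalD addNr dval0.
Qed.

Lemma dvalB f g z : dval (f - g) z = dval f z - dval g z.
Proof. by rewrite dvalD dvalN. Qed.

Lemma dval1 z : modulus z <= 1 -> dval 1 z = 1.
Proof. by move=> z1; rewrite (dvalE _ z1). Qed.

Lemma dvalA a z : modulus z <= 1 -> dval a%:A z = a.
Proof.
move=> z1; rewrite (dvalE _ z1) -[RHS]mulr1.
exact: (erefl : (a *: (1 : disc_alg)) _ = _).
Qed.

Lemma dvalX f n z : modulus z <= 1 -> dval (f ^+ n) z = dval f z ^+ n.
Proof.
move=> z1; elim: n => [|n IH]; first by rewrite !expr0 dval1.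
by rewrite !exprS dvalM IH.
Qed.

Lemma disc_alg_unitP f :
  f \is a GRing.unit <-> forall z, modulus z <= 1 -> dval f z != 0.
Proof.
split=> [fU z z1|f0].
  have := congr1 (dval^~ z) (divrr fU); rewrite /= dvalM dval1//.
  by apply: contra_eq_neq => ->; rewrite mul0r eq_sym oner_eq0.
have [g gE] := disc_alg_of (disc_holV f0 (disc_hol_dval f)).
apply/unitrP; exists g; suff gf : g * f = 1 by split; rewrite // mulrC.
by apply: dvalP => z z1; rewrite dvalM gE// mulVf ?f0// dval1.
Qed.

Lemma dval_uniform f e : 0 < e -> exists2 d, 0 < d & forall z w,
  modulus z <= 1 -> modulus w <= 1 -> modulus (z - w) < d ->
  modulus (dval f z - dval f w) < e.
Proof.
move: e; apply: (@heine _ [set z | modulus z <= 1]) => [|z z1 e e0].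
  exact: compact_disc.
have [/(_ z z1)/within_modulusP/(_ _ e0)[d d0 hd] _] := disc_hol_dval f.
by exists d => // w w1; exact: hd.
Qed.

Lemma dval_bounded f : exists2 K, 0 < K & forall z, modulus z <= 1 -> modulus (dval f z) <= K.
Proof.
exists (`|sup (moduli f)| + 1); first by rewrite ltr_wpDl.
move=> z z1; rewrite (dvalE _ z1) (le_trans (sup_norm_ub _ _))//.
by rewrite (le_trans (ler_norm _))// lerDl.
Qed.

Definition dX : disc_alg := projT1 (cid (disc_alg_of (@disc_hol_id R))).

Definition dpoly (p : {poly C}) : disc_alg := horner_alg dX p.

Lemma dval_poly p z : modulus z <= 1 -> dval (dpoly p) z = p.[z].
Proof.
move=> z1; elim/poly_ind: p => [|p c IH].
  by rewrite /dpoly rmorph0 horner0 -[0 in LHS](subrr 1) dvalB subrr.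
rewrite /dpoly rmorphD rmorphM/= horner_algX horner_algC dvalD dvalM dvalA//.
rewrite -/(dpoly p) IH !hornerE; congr (_ * _ + _).
by rewrite /dX; case: cid => /= f /(_ z z1).
Qed.

(** The dilated function [f (r z)], uniformly close to [f] for [r] near [1],
    only involves values on a closed disc inside the domain of holomorphy. *)
Theorem disc_alg_poly_approx f e : 0 < e -> exists p : {poly C},
  forall z, modulus z <= 1 -> modulus (dval f z - p.[z]) <= e.
Proof.
move=> e0; have e20 : 0 < e / 2 by rewrite divr_gt0.
have [d d0 hd] := dval_uniform f e20.
pose r := Num.max 2^-1 (1 - d / 2).
have r0 : 0 < r by rewrite lt_max invr_gt0 ltr0n.
have r1 : r < 1 by rewrite gt_max invf_lt1// ltr1n ltrBlDr ltrDl divr_gt0.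
have rd : 1 - r < d.
  have : 1 - d / 2 <= r by rewrite le_max lexx orbT.
  by lra.
have [_ df] := disc_hol_dval f.
have [p hp] := holomorphic_poly_approx r0 r1 e20 df.
exists (p \Po (r%:C%C *: 'X)) => z z1; rewrite horner_comp !hornerE.
have rz : modulus (r%:C%C * z) <= r.
  by rewrite modulusM modulusR (ger0_norm (ltW r0)) ler_piMr// ltW.
rewrite [e]splitr; apply: (le_trans (modulusBB _ (dval f (r%:C%C * z)) _)).
apply: lerD; last exact: hp.
apply/ltW/hd => //; first exact: le_trans rz (ltW r1).
have -> : z - r%:C%C * z = (1 - r)%:C%C * z by rewrite rmorphB/= rmorph1; ring.
rewrite modulusM modulusR ger0_norm ?subr_ge0 ?(ltW r1)//.
by rewrite (le_lt_trans _ rd)// ler_piMr// subr_ge0 ltW.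
Qed.

(** Along the radii, [f (t z)] is a path from the constant [f 0] to [f] with
    values in the nonzero numbers; a logarithm of [f] is a sum of principal
    logarithms of the ratios between successive points of a fine subdivision. *)
Theorem disc_alg_log f : f \is a GRing.unit ->
  exists g, forall z, modulus z <= 1 -> cexp (dval g z) = dval f z.
Proof.
move=> fU; have /disc_alg_unitP f0 := fU.
have [K K0 hK] := dval_bounded f^-1.
have Ki : 0 < K^-1 by rewrite invr_gt0.
have [d d0 hd] := dval_uniform f Ki.
have [n n0 hn] : exists2 n, (0 < n)%N & n%:R^-1 < d.
  exists (Num.truncn d^-1).+1 => //.
  rewrite invf_plt ?posrE ?ltr0n//.
  exact: truncnS_gt.
pose t k : R := k%:R / n%:R.
have t01 k : (k <= n)%N -> 0 <= t k <= 1.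
  move=> kn; rewrite divr_ge0//= ler_pdivrMr ?ltr0n// mul1r ler_nat.
  exact: kn.
have mt k z : (k <= n)%N -> modulus z <= 1 -> modulus ((t k)%:C%C * z) <= 1.
  move=> /t01/andP[t0 t1] z1; rewrite modulusM modulusR (ger0_norm t0).
  by rewrite mulr_ile1// modulus_ge0.
have nz k z : (k <= n)%N -> modulus z <= 1 -> dval f ((t k)%:C%C * z) != 0.
  by move=> kn z1; apply/f0/mt.
(* by the choice of [n] these ratios lie within distance [1] of [1], hence in
   the domain of [clog] *)
pose q k z := dval f ((t k.+1)%:C%C * z) / dval f ((t k)%:C%C * z).
have Req k z : (k < n)%N -> modulus z <= 1 -> 0 < complex.Re (q k z).
  move=> kn z1; have zk := mt k z (ltnW kn) z1; have zk1 := mt k.+1 z kn z1.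
  have small : modulus (q k z - 1) < 1.
    have -> : q k z - 1 = (dval f ((t k.+1)%:C%C * z) - dval f ((t k)%:C%C * z)) *
        dval f^-1 ((t k)%:C%C * z).
      have := congr1 (dval^~ ((t k)%:C%C * z)) (divrr fU); rewrite /= dvalM dval1//.
      move=> /(canRL (mulKf (nz k z (ltnW kn) z1))) ->; rewrite mulr1 /q mulrBl.
      by rewrite divff// nz// ltnW.
    rewrite modulusM; apply: (@lt_le_trans _ _ (K^-1 * K)); last by rewrite mulVf ?gt_eqF.
    apply: (@le_lt_trans _ _ (modulus (dval f ((t k.+1)%:C%C * z) - dval f ((t k)%:C%C * z)) * K)).
      by rewrite ler_wpM2l ?modulus_ge0// hK.
    rewrite ltr_pM2r//; apply: hd => //.
    rewrite -mulrBl -rmorphB/= modulusM modulusR.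
    have -> : t k.+1 - t k = n%:R^-1 by rewrite /t -mulrBl -natrB// subSnn mul1r.
    by rewrite ger0_norm ?invr_ge0// (le_lt_trans _ hn)// ler_piMr// invr_ge0.
  exact: (@Re_gt0_near _ 1).
have m01 : modulus (0 : C) <= 1 by rewrite modulus0.
have [c hc] := cexp_onto (f0 0 m01).
have dil k (kn : (k <= n)%N) := disc_hol_dilate (t01 k kn) (disc_hol_dval f).
have hq k (kn : (k < n)%N) : disc_hol (q k).
  exact: (disc_holM (dil _ kn) (disc_holV (fun z => nz k z (ltnW kn)) (dil _ (ltnW kn)))).
have hlog (k : 'I_n) : disc_hol (@clog R \o q k).
  have dlog z (z1 : modulus z <= 1) : derivable (@clog R) (q k z) 1.
    exact: derivable_clog (Req k z (ltn_ord k) z1).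
  exact: (disc_hol_comp dlog (hq k (ltn_ord k))).
have hol := disc_holD (disc_hol_cst c) (disc_hol_sum hlog).
have [g hg] := disc_alg_of hol; exists g => z z1; rewrite hg//.
have tele m : (m <= n)%N -> cexp (c + \sum_(k < m) (@clog R \o q k) z) =
    dval f ((t m)%:C%C * z).
  elim: m => [|m IH] mn; first by rewrite big_ord0 addr0 hc /t mul0r rmorph0 mul0r.
  rewrite big_ord_recr/= addrA cexpD IH ?(ltnW mn)// clogK ?Req//.
  by rewrite /q mulrCA divff ?mulr1// nz// ltnW.
by rewrite tele// /t divff ?pnatr_eq0 -?lt0n// rmorph1 mul1r.
Qed.

End DiscAlgebraElements.

(** * Reducible pairs in a commutative ring *)

Section Reducible.
Variable A : comUnitRingType.
Implicit Types f g h k x : A.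

(** The class of [f] modulo [g] lifts to a unit of the ring.  Bass' stable
    rank is one when this holds for every pair generating the unit ideal. *)
Definition reducible g f := exists x, f + x * g \is a GRing.unit.

Lemma reducible_unit g f : f \is a GRing.unit -> reducible g f.
Proof. by move=> fU; exists 0; rewrite mul0r addr0. Qed.

Lemma reducibleM g f k : reducible g f -> reducible g k -> reducible g (f * k).
Proof.
move=> [x xU] [y yU]; exists (f * y + x * k + x * y * g).
have -> : f * k + (f * y + x * k + x * y * g) * g = (f + x * g) * (k + y * g).
  by ring.
by rewrite unitrM xU yU.
Qed.

Lemma reducible_prod (I : eqType) g (s : seq I) (F : I -> A) :
  (forall a, a \in s -> reducible g (F a)) -> reducible g (\prod_(a <- s) F a).
Proof.
elim: s => [|a s IH] hF.
  by rewrite big_nil; apply: reducible_unit; exact: unitr1.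
rewrite big_cons; apply: reducibleM; first by apply: hF; rewrite inE eqxx.
by apply: IH => b bs; apply: hF; rewrite inE bs orbT.
Qed.

(** Modulo [g], [f] is a unit with inverse [h], so that [f (1 - (f - f') h)]
    is congruent to [f'].  How close [f'] must be to [f] depends on [h] only,
    not on the way [f'] is reduced: reducibility is a closed condition on the
    [f] that generate the unit ideal together with [g]. *)
Lemma reducible_close g f f' h k : f * h + k * g = 1 ->
  1 - (f - f') * h \is a GRing.unit -> reducible g f' -> reducible g f.
Proof.
set w := 1 - (f - f') * h => bez wU [x xU]; exists ((x - (f - f') * k) / w).
suff -> : f + (x - (f - f') * k) / w * g = (f' + x * g) / w.
  by rewrite unitrM xU unitrV.
apply: (mulIr wU); rewrite mulrDl mulrVK//.
rewrite [_ / w * g]mulrAC mulrVK// /w.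
have -> : f * (1 - (f - f') * h) = f - (f - f') * (f * h) by ring.
have -> : f * h = 1 - k * g by rewrite -bez addrK.
by ring.
Qed.

Lemma bezout_of_unit_sub f g k : g - f * k \is a GRing.unit ->
  f * (- k / (g - f * k)) + (g - f * k)^-1 * g = 1.
Proof.
set v := g - f * k => vU; apply: (mulIr vU).
rewrite mulrDl mulrA mulrVK// mulrAC mulVr// mul1r mul1r /v.
by ring.
Qed.

End Reducible.

(** * Stable rank of the disc algebra *)

Section StableRank.
Variable R : realType.
Local Notation C := (Cplx R).
Local Notation disc_alg := (disc_alg R).
Implicit Types (z w a : C) (r e t d : R) (f g h k x : disc_alg) (p q : {poly C}).

Lemma unit_1B f : (forall z, modulus z <= 1 -> modulus (dval f z) < 1) ->
  1 - f \is a GRing.unit.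
Proof.
move=> f1; apply/disc_alg_unitP => z z1; rewrite dvalB dval1// subr_eq0.
by apply: contraTneq (f1 z z1) => <-; rewrite modulus1 ltxx.
Qed.

Definition dlin a : disc_alg := dX R - a%:A.

Lemma dval_lin a z : modulus z <= 1 -> dval (dlin a) z = z - a.
Proof.
move=> z1; rewrite dvalB dvalA//; congr (_ - _).
by have := dval_poly 'X z1; rewrite /dpoly horner_algX hornerX.
Qed.

Lemma dpoly_lin a : dpoly ('X - a%:P) = dlin a.
Proof. by rewrite /dpoly rmorphB/= horner_algX horner_algC. Qed.

Lemma dlin_unit a : 1 < modulus a -> dlin a \is a GRing.unit.
Proof.
move=> a1; apply/disc_alg_unitP => z z1; rewrite dval_lin// subr_eq0.
by apply: contraTneq a1 => <-; rewrite -leNgt.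
Qed.

(** Dividing a polynomial approximation of [g] by [z - a] leaves a remainder
    close to the nonzero number [g a]. *)
Lemma bezout_dlin g a : modulus a <= 1 -> dval g a != 0 ->
  exists h k, dlin a * h + k * g = 1.
Proof.
move=> a1 ga0; pose m := modulus (dval g a); have m0 : 0 < m by rewrite modulus_gt0.
have m30 : 0 < m / 3 by rewrite divr_gt0.
have [p hp] := disc_alg_poly_approx g m30.
have [q pq] : exists q, p - (p.[a])%:P = q * ('X - a%:P).
  by apply/factor_theorem; rewrite /root !hornerE subrr.
have vU : g - dlin a * dpoly q \is a GRing.unit.
  apply/disc_alg_unitP => z z1; rewrite dvalB dvalM dval_lin// dval_poly//.
  have -> : (z - a) * q.[z] = p.[z] - p.[a].
    have := congr1 (horner^~ z) pq; rewrite !hornerE => ->.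
    by rewrite mulrC.
  have h1 := hp z z1; have h2 := hp a a1.
  apply/negP => /eqP E.
  have := modulusBB (dval g a) p.[a] 0; rewrite !subr0 -/m.
  have pE : p.[a] = - (dval g z - p.[z]).
    by apply/eqP; rewrite -addr_eq0 -E; apply/eqP; ring.
  have : modulus p.[a] <= m / 3 by rewrite pE modulusN.
  by lra.
by exists (- dpoly q / (g - dlin a * dpoly q)), (g - dlin a * dpoly q)^-1; exact: bezout_of_unit_sub.
Qed.

Lemma not_reducible_near g a : modulus a <= 1 -> dval g a != 0 ->
  ~ reducible g (dlin a) ->
  exists2 d, 0 < d & forall b, modulus (b - a) < d -> ~ reducible g (dlin b).
Proof.
move=> a1 ga nred; have [h [k bez]] := bezout_dlin a1 ga.
have [K K0 hK] := dval_bounded h.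
exists K^-1; first by rewrite invr_gt0.
move=> b ba red; apply: nred; apply: (reducible_close bez _ red); apply: unit_1B => z z1.
rewrite dvalM dvalB !dval_lin// modulusM.
have -> : z - a - (z - b) = b - a by ring.
apply: (@le_lt_trans _ _ (modulus (b - a) * K)).
  by rewrite ler_wpM2l ?modulus_ge0// hK.
by rewrite -(mulVf (lt0r_neq0 K0)) ltr_pM2r.
Qed.

Lemma reducible_near g a : reducible g (dlin a) ->
  exists2 d, 0 < d & forall b, modulus (b - a) < d -> reducible g (dlin b).
Proof.
move=> [x xU]; have [K K0 hK] := dval_bounded (dlin a + x * g)^-1.
exists K^-1; first by rewrite invr_gt0.
move=> b ba; exists x.
have -> : dlin b + x * g = (dlin a + x * g) * (1 - (b - a)%:A * (dlin a + x * g)^-1).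
  by rewrite mulrBr mulr1 mulrCA divrr// mulr1 /dlin scalerBl opprB [RHS]addrAC addrA subrK.
rewrite unitrM xU unit_1B// => z z1; rewrite dvalM dvalA// modulusM.
apply: (@le_lt_trans _ _ (modulus (b - a) * K)).
  by rewrite ler_wpM2l ?modulus_ge0// hK.
by rewrite -(mulVf (lt0r_neq0 K0)) ltr_pM2r.
Qed.

Lemma sqr_modulus z : modulus z ^+ 2 = complex.Re z ^+ 2 + complex.Im z ^+ 2.
Proof.
by rewrite /modulus /Cplx normc_def/= sqr_sqrtr// addr_ge0// sqr_ge0.
Qed.

Lemma derivable_horner p z : derivable (horner p) z 1.
Proof.
elim/poly_ind: p => [|p c IH].
  by rewrite (_ : horner 0 = cst 0); [exact: derivable_cst|apply/funext => w; rewrite horner0].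
rewrite (_ : horner _ = horner p * id + cst c); last first.
  by apply/funext => w; rewrite !hornerE.
exact: derivableD (derivableM IH (@derivable_id _ _ z 1)) (derivable_cst c z 1).
Qed.

(** The maximum principle, with a strictly subharmonic term added so that the
    equality case needs no separate treatment: over a circle centered at [a],
    the mean of the added term exceeds its value at [a]. *)
Lemma poly_max_principle p a r e : 0 < r -> r < 1 -> 0 < e -> p.[a] != 0 ->
  exists2 b, modulus (b - a) = r &
    modulus p.[a] + e * modulus a ^+ 2 < modulus p.[b] + e * modulus b ^+ 2.
Proof.
move=> r0 r1 e0 pa0; apply: contrapT => no.
have le b : modulus (b - a) = r ->
    modulus p.[b] + e * modulus b ^+ 2 <= modulus p.[a] + e * modulus a ^+ 2.
  by move=> br; rewrite leNgt; apply/negP => lt; apply: no; exists b.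
have m0 : 0 < modulus p.[a] by rewrite modulus_gt0.
(* [c] rotates [p.[a]] to its modulus; the linear term of [P] is the cross
   term in the expansion of [e * modulus (z + a) ^+ 2] *)
pose c : C := (modulus p.[a])%:C%C / p.[a].
have c1 : modulus c = 1.
  by rewrite modulusM modulusV modulusR ger0_norm ?modulus_ge0// divff// gt_eqF.
pose P : {poly C} := c *: (p \Po ('X + a%:P)) + ((2 * e)%:C%C * (a^*)%C) *: 'X.
have PE z : P.[z] = c * p.[z + a] + (2 * e)%:C%C * (a^*)%C * z.
  by rewrite /P !hornerE horner_comp !hornerE.
have dP z : modulus z < 1 -> derivable (horner P) z 1 by move=> _; exact: derivable_horner.
have m0r : modulus (0 : C) < r by rewrite modulus0.
have := cauchy_formula m0r r1 dP.
rewrite (@eq_mean _ _ _ (horner P)) ?(ltW r0)//; last first.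
  move=> z zr; rewrite subr0 divff ?mulr1//.
  by rewrite -modulus_gt0 zr.
rewrite PE add0r mulr0 addr0 mulfVK// => E.
have cP : cont_circle r (horner P).
  by move=> z _; apply: derivable_continuous; exact: derivable_horner.
have := Re_mean_le (ltW r0) cP (K := modulus p.[a] - e * r ^+ 2); rewrite E [complex.Re _]/=.
have er : 0 < e * r ^+ 2 by rewrite mulr_gt0// exprn_gt0.
suff h : forall z, modulus z = r -> complex.Re P.[z] <= modulus p.[a] - e * r ^+ 2.
  by move=> /(_ h); rewrite lerBrDr gerDl leNgt er.
move=> z zr; have := le (z + a); rewrite addrK => /(_ zr).
have : complex.Re (c * p.[z + a]) <= modulus p.[z + a].
  by rewrite -[leRHS]mul1r -c1 -modulusM (le_trans (ler_norm _))// Re_le_modulus.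
rewrite PE -zr !sqr_modulus.
move: (c * p.[z + a]) (modulus p.[z + a]) (modulus p.[a]) => [u v] M N /=.
case: (z) (a) => [z1 z2] [a1 a2] /=.
rewrite !mul0r !subr0 !addr0 !mulrN => h1 h2.
have zE : 2 * e * (a1 * z1 + a2 * z2) = e * ((z1 + a1) ^+ 2 + (z2 + a2) ^+ 2)
  - e * (a1 ^+ 2 + a2 ^+ 2) - e * (z1 ^+ 2 + z2 ^+ 2) by ring.
by lra.
Qed.

Lemma compact_closure_disc (A : set C) : closure A `<=` [set z | modulus z <= 1] ->
  compact (closure A).
Proof.
move=> A1; apply: (subclosed_compact _ (@compact_disc R 1 (lexx _)) A1).
exact: closed_closure.
Qed.

(** The bad points [a], with [g a] nonzero and [z - a] not reducible, form a
    set [B] that is open in the plane, because [z - a] is a unit for [a]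
    outside the closed disc, and closed away from the zeros of [g].  So [g]
    vanishes on the boundary of [B].  A polynomial close to [g] would then be
    larger somewhere in [B] than on its boundary, against the maximum
    principle.  In other words, [a] can be pushed out of the disc without
    meeting a zero of [g]. *)
Theorem reducible_dlin g a : modulus a <= 1 -> dval g a != 0 -> reducible g (dlin a).
Proof.
move=> a1 ga0; apply: contrapT => nred.
pose B : set C := [set b | [/\ modulus b <= 1, dval g b != 0 & ~ reducible g (dlin b)]].
have Ba : B a by [].
have cB1 : closure B `<=` [set z | modulus z <= 1].
  move=> b bB /=; rewrite leNgt; apply/negP => b1.
  have /bB[c [[c1 _ _]]] : nbhs b [set c | modulus (c - b) < modulus b - 1].
    by apply/near_modulusP; exists (modulus b - 1); rewrite ?subr_gt0.
  rewrite /= modulus_distC; have := modulusBB b c 0; rewrite !subr0.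
  by lra.
have cptB := compact_closure_disc cB1.
pose m := modulus (dval g a); have m0 : 0 < m by rewrite modulus_gt0.
have m30 : 0 < m / 3 by rewrite divr_gt0.
have m60 : 0 < m / 6 by rewrite divr_gt0.
have [p hp] := disc_alg_poly_approx g m30.
pose psi (z : C) : R := modulus p.[z] + m / 6 * modulus z ^+ 2.
have cpsi : continuous psi.
  move=> z; have cp : {for z, continuous (fun z => modulus p.[z])}.
    have ch := derivable_continuous (@derivable_horner p z).
    exact: (@continuous_comp _ _ _ (horner p) (@modulus R) z ch (@continuous_modulus R _)).
  have cm := @continuous_modulus R z.
  have cmm : {for z, continuous (fun z => modulus z ^+ 2 : R)}.
    exact: (continuousM cm cm).
  have ccm : {for z, continuous (fun z => m / 6 * modulus z ^+ 2 : R)}.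
    exact: (continuousM (@cst_continuous _ _ (m / 6 : R) z) cmm).
  exact: (continuousD cp ccm).
have B0 : closure B !=set0 by exists a; exact: subset_closure.
have [b /set_mem bB bmax] := compact_EVT_max B0 cptB (continuous_subspaceT cpsi).
have b1 := cB1 b bB.
have sqb : modulus b ^+ 2 <= 1 by rewrite expr_le1// modulus_ge0.
have pa : m - m / 3 <= modulus p.[a].
  have := hp a a1; have := modulusBB (dval g a) p.[a] 0; rewrite !subr0 -/m; lra.
have pb : m / 2 <= modulus p.[b].
  have := bmax a (mem_set (subset_closure Ba)); rewrite /psi.
  have : 0 <= m / 6 * modulus a ^+ 2 by rewrite mulr_ge0 ?sqr_ge0// ltW.
  have : m / 6 * modulus b ^+ 2 <= m / 6 by rewrite ler_piMr// ltW.
  by lra.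
have gb : 0 < modulus (dval g b).
  have := hp b b1; have := modulusBB p.[b] (dval g b) 0; rewrite !subr0 modulus_distC.
  by lra.
have Bb : B b.
  split => //; first by rewrite -modulus_gt0.
  move=> /reducible_near[d d0 hd].
  have /bB[c [[_ _ +]]] : nbhs b [set c | modulus (c - b) < d].
    by apply/near_modulusP; exists d.
  by move=> nc /hd.
have [_ gb0 nb] := Bb.
have [d1 d10 hd1] := not_reducible_near b1 gb0 nb.
have [/(_ b b1)/within_modulusP/(_ _ gb)[d2 d20 hd2] _] := disc_hol_dval g.
pose r := Num.min (2^-1) (Num.min (d1 / 2) (d2 / 2)).
have r0 : 0 < r by rewrite !lt_min invr_gt0 ltr0n !divr_gt0.
have r1 : r < 1 by rewrite gt_min invf_lt1// ltr1n.
have rd1 : r < d1.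
  by rewrite !gt_min; apply/orP; right; apply/orP; left; rewrite gtr_pMr// invf_lt1// ltr1n.
have rd2 : r < d2.
  by rewrite !gt_min; apply/orP; right; apply/orP; right; rewrite gtr_pMr// invf_lt1// ltr1n.
have pb0 : p.[b] != 0 by rewrite -modulus_gt0 (lt_le_trans _ pb)// divr_gt0.
have [c cb] := poly_max_principle r0 r1 m60 pb0.
apply/negP; rewrite -leNgt; apply/bmax/mem_set/subset_closure.
have nc : ~ reducible g (dlin c) by apply: hd1; rewrite cb.
have c1 : modulus c <= 1.
  by rewrite leNgt; apply/negP => /dlin_unit/(reducible_unit g).
split => //; have := hd2 c c1; rewrite cb => /(_ rd2).
by apply: contraTneq => ->; rewrite sub0r modulusN ltxx.
Qed.

(** A polynomial close to [f] still has no common zero with [g]; its linear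
    factors are reducible, hence so are the polynomial and [f]. *)
Theorem disc_alg_stable_rank g f h k : f * h + k * g = 1 -> reducible g f.
Proof.
move=> bez; have [K K0 hK] := dval_bounded h.
have e0 : 0 < (2 * K)^-1 by rewrite invr_gt0 mulr_gt0.
have [p hp] := disc_alg_poly_approx f e0.
have close z : modulus z <= 1 -> modulus (dval ((f - dpoly p) * h) z) < 1.
  move=> z1; rewrite dvalM dvalB dval_poly// modulusM.
  apply: (@le_lt_trans _ _ ((2 * K)^-1 * K)).
    by rewrite ler_pM ?modulus_ge0 ?hK ?hp.
  by rewrite invfM mulfVK ?gt_eqF// invf_lt1// ltr1n.
apply: (reducible_close bez (unit_1B close)).
have bezE z : modulus z <= 1 -> p.[z] = 0 -> dval g z != 0.
  move=> z1 pz; apply: contraTneq (close z z1) => gz; rewrite -leNgt.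
  have := congr1 (fun u => dval u z) bez; rewrite /= dvalD dval1// !dvalM dvalB dval_poly//.
  by rewrite gz mulr0 addr0 pz subr0 => ->; rewrite modulus1.
have [p0|p0] := eqVneq p 0; last first.
  have [s ps] := closed_field_poly_normal p.
  have -> : dpoly p = (lead_coef p)%:A * \prod_(a <- s) dlin a.
    rewrite {1}ps /dpoly -mul_polyC rmorphM/= horner_algC rmorph_prod; congr (_ * _).
    by apply: eq_bigr => a _; exact: dpoly_lin.
  apply: reducibleM.
    apply/reducible_unit/disc_alg_unitP => z z1.
    by rewrite dvalA// lead_coef_eq0.
  apply: reducible_prod => a as_; have [a1|a1] := leP (modulus a) 1.
    apply: reducible_dlin => //; apply: bezE => //.
    by rewrite ps hornerZ; apply/eqP; rewrite mulf_eq0 -/(root _ _) root_prod_XsubC as_ orbT.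
  exact/reducible_unit/dlin_unit.
exists 1; rewrite p0 /dpoly rmorph0 add0r mul1r.
by apply/disc_alg_unitP => z z1; apply: bezE => //; rewrite p0 horner0.
Qed.

End StableRank.

(** * Limits of matrices *)

Section MatrixTopology.

Lemma cvg_mxP (T : topologicalType) m n (u : nat -> 'M[T]_(m, n)) (M : 'M[T]_(m, n)) :
  (forall i j, (fun k => u k i j) @ \oo --> M i j) -> u @ \oo --> M.
Proof.
move=> uM A [P MP PA].
have : \forall k \near \oo, forall i j, P i j (u k i j).
  by apply: filter_forall => i; apply: filter_forall => j; exact: uM (MP i j).
by apply: filterS => k uk; exact: PA.
Qed.

Lemma mx_hausdorff (T : topologicalType) m n :
  hausdorff_space T -> hausdorff_space 'M[T]_(m, n).
Proof.
move=> hT M N cMN; apply/matrixP => i j; apply: hT => A B MA NB.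
have entry (L : 'M[T]_(m, n)) (E : set T) :
    nbhs (L i j) E -> nbhs L [set K | E (K i j)].
  move=> LE; exists (fun i' j' => if (i' == i) && (j' == j) then E else setT).
    by move=> i' j'; case: ifP => [/andP[/eqP -> /eqP ->]//|_]; exact: filterT.
  by move=> K /(_ i j); rewrite !eqxx.
by have [K [AK BK]] := cMN _ _ (entry M A MA) (entry N B NB); exists (K i j).
Qed.

End MatrixTopology.

(** * Exponentials of diagonalizable matrices *)

Section ConjDiag.
Variables (A : comNzRingType) (n : nat) (V W : 'M[A]_n.+1) (d : 'rV[A]_n.+1).

Lemma conj_diagE (x : 'rV[A]_n.+1) i j :
  (V *m diag_mx x *m W) i j = \sum_l V i l * x 0 l * W l j.
Proof. by rewrite mul_mx_diag mxE; apply: eq_bigr => l _; rewrite mxE. Qed.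

Hypothesis WV : W *m V = 1%:M.

Lemma conj_diag_expr k :
  (V *m diag_mx d *m W) ^+ k = V *m diag_mx (\row_l d 0 l ^+ k) *m W.
Proof.
elim: k => [|k IH].
  rewrite expr0 (_ : diag_mx _ = 1%:M) ?mulmx1 ?(mulmx1C WV)//.
  by apply/matrixP => i j; rewrite !mxE; case: eqP.
rewrite exprS IH -mulmxE !mulmxA; congr (_ *m _).
rewrite -(mulmxA _ W V) WV mulmx1 -mulmxA mulmx_diag; congr (_ *m diag_mx _).
by apply/rowP => l; rewrite !mxE exprS.
Qed.

Lemma conj_diag_sum (a : nat -> A) N i j :
  (\sum_(0 <= k < N) a k *: (V *m diag_mx d *m W) ^+ k) i j =
  \sum_l V i l * (\sum_(k < N) a k * d 0 l ^+ k) * W l j.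
Proof.
rewrite big_mkord summxE.
under eq_bigr => k _ do rewrite mxE conj_diag_expr conj_diagE mulr_sumr.
rewrite exchange_big/=; apply: eq_bigr => l _.
rewrite mulr_sumr mulr_suml; apply: eq_bigr => k _.
by rewrite mxE; ring.
Qed.

End ConjDiag.

Section MatrixExponential.
Variable R : realType.
Local Notation C := (Cplx R).
Local Notation disc_alg := (disc_alg R).
Implicit Types (z w a : C) (e : R) (f g : disc_alg).

Lemma cvg_disc_algP (u : nat -> disc_alg) g : u @ \oo --> g <->
  forall e, 0 < e -> \forall n \near \oo, forall z, modulus z <= 1 ->
    modulus (dval (u n) z - dval g z) <= e.
Proof.
split=> [ug e e0|ug].
  have e0' : 0 < e%:C%C :> C by rewrite /Cplx ltcR.
  have /cvgrPdist_lt/(_ _ e0') := ug; apply: filterS => n ugn z z1.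
  rewrite modulus_distC -dvalB (dvalE _ z1).
  apply: (le_trans (sup_norm_ub _ _)); apply: ltW.
  by move: ugn; rewrite /Num.norm/= /sup_norm /Cplx ltcR.
apply/cvgrPdist_le => e e0.
have e0' : 0 < complex.Re e by move: e0; rewrite /Cplx ltcE => /andP[].
have eE : e = (complex.Re e)%:C%C :> C.
  by move: (ger0_Im (ltW e0)) => {e0 e0'}; case: e => a b /= ->.
apply: filterS (ug _ e0') => n hn.
rewrite eE /Num.norm/= /sup_norm /Cplx lecR; apply: sup_norm_le => x.
by rewrite dval_val dvalB modulus_distC; apply: hn; exact: modulus_cdisc.
Qed.

Lemma cvg_mul_const (u : nat -> disc_alg) f g h :
  u @ \oo --> g -> (fun n => f * u n * h) @ \oo --> f * g * h.
Proof.
move=> /cvg_disc_algP ug; apply/cvg_disc_algP => e e0.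
have [K K0 hK] := dval_bounded f; have [L L0 hL] := dval_bounded h.
have d0 : 0 < e / (K * L) by rewrite divr_gt0// mulr_gt0.
apply: filterS (ug _ d0) => n hn z z1.
have -> : dval (f * u n * h) z - dval (f * g * h) z =
    dval f z * (dval (u n) z - dval g z) * dval h z.
  by rewrite !dvalM; ring.
rewrite !modulusM; apply: (@le_trans _ _ (K * (e / (K * L)) * L)).
  by rewrite ler_pM ?mulr_ge0 ?modulus_ge0 ?hL// ler_pM ?modulus_ge0 ?hK ?hn.
by rewrite le_eqVlt; apply/orP; left; apply/eqP; field; rewrite !gt_eqF.
Qed.

Lemma cvg_big_ord n (u : nat -> 'I_n -> disc_alg) (g : 'I_n -> disc_alg) :
  (forall l, (fun k => u k l) @ \oo --> g l) ->
  (fun k => \sum_(l < n) u k l) @ \oo --> \sum_(l < n) g l.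
Proof.
elim: n u g => [|n IH] u g ug.
  by under eq_fun do rewrite big_ord0; rewrite big_ord0; exact: cvg_cst.
under eq_fun do rewrite big_ord_recr; rewrite big_ord_recr.
exact: (cvgD (IH (fun k l => u k (widen_ord (leqnSn n) l)) _ (fun l => ug _)) (ug ord_max)).
Qed.

Definition exp_term f k : disc_alg := (k`!%:R^-1 : C)%:A * f ^+ k.

Lemma dval_exp_sum f n z : modulus z <= 1 ->
  dval (\sum_(k < n) exp_term f k) z = exp_sum n (dval f z).
Proof.
move=> z1; elim: n => [|n IH].
  by rewrite /exp_sum !big_ord0 -[0 in LHS](subrr 1) dvalB subrr.
by rewrite /exp_sum !big_ord_recr/= dvalD IH dvalM dvalA// dvalX.
Qed.

Lemma cvg_disc_alg_exp f g : (forall z, modulus z <= 1 -> cexp (dval f z) = dval g z) ->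
  (fun n => \sum_(k < n) exp_term f k) @ \oo --> g.
Proof.
move=> fg; apply/cvg_disc_algP => e e0; have [K K0 hK] := dval_bounded f.
have /cvgrPdist_lt/(_ _ e0) := @cvg_exp_sumR R K; apply: filterS => n hn z z1.
rewrite dval_exp_sum// -fg// modulus_distC (le_trans (modulus_cexpB n (hK z z1)))//.
exact: le_trans (ler_norm _) (ltW hn).
Qed.

(** The entries of the partial sums are fixed linear combinations of partial
    sums of the exponential series of the eigenvalues. *)
Theorem mexp_diag n (V W : 'M[disc_alg]_n.+1) (d e : 'rV[disc_alg]_n.+1) :
  W *m V = 1%:M ->
  (forall j z, modulus z <= 1 -> cexp (dval (d 0 j) z) = dval (e 0 j) z) ->
  mexp (V *m diag_mx d *m W) = V *m diag_mx e *m W.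
Proof.
move=> WV de; rewrite /mexp; apply: cvg_lim.
  by apply: mx_hausdorff; exact: norm_hausdorff.
apply: cvg_mxP => i j; rewrite conj_diagE.
have -> : (fun k => series (fun k => ((k`!%:R^-1 : C)%:A : disc_alg) *:
      (V *m diag_mx d *m W) ^+ k) k i j) =
    (fun k => \sum_l V i l * (\sum_(m < k) exp_term (d 0 l) m) * W l j).
  by apply/funext => k; exact: (conj_diag_sum d WV).
apply: cvg_big_ord => l; apply: cvg_mul_const.
by apply: cvg_disc_alg_exp => z z1; exact: de.
Qed.

End MatrixExponential.

(** * Triangular factors of two by two matrices *)

Section Matrices2.
Variable A : comUnitRingType.
Implicit Types (a b c d p q : A).

Definition mx2 a b c d : 'M[A]_2 := \matrix_(i, j)
  if i == 0 then if j == 0 then a else b else if j == 0 then c else d.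

Lemma mx2_eta (M : 'M[A]_2) : M = mx2 (M 0 0) (M 0 1) (M 1 0) (M 1 1).
Proof.
by apply/matrixP => -[[|[|//]] hi] [[|[|//]] hj]; rewrite !mxE/=; congr (M _ _); apply/val_inj.
Qed.

Lemma mul_mx2 a b c d a' b' c' d' : mx2 a b c d *m mx2 a' b' c' d' =
  mx2 (a * a' + b * c') (a * b' + b * d') (c * a' + d * c') (c * b' + d * d').
Proof.
by apply/matrixP => -[[|[|//]] hi] [[|[|//]] hj];
  rewrite !mxE !big_ord_recl big_ord0 !mxE/= addr0.
Qed.

Lemma mx2_1 : 1%:M = mx2 1 0 0 1.
Proof. by apply/matrixP => -[[|[|//]] hi] [[|[|//]] hj]; rewrite !mxE. Qed.

Lemma diag_mx2 p q : diag_mx (\row_(j < 2) if j == 0 then p else q) = mx2 p 0 0 q.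
Proof. by apply/matrixP => -[[|[|//]] hi] [[|[|//]] hj]; rewrite !mxE. Qed.

Lemma det_mx2 a b c d : \det (mx2 a b c d) = a * d - b * c.
Proof.
rewrite (expand_det_row _ 0) !big_ord_recl big_ord0 /cofactor !det_mx11 !mxE/=.
by rewrite addr0 expr0 expr1 mul1r mulN1r mulrN.
Qed.

(** Diagonalizable over [A] itself, with unit eigenvalues: over the disc
    algebra, units have logarithms, and such matrices are exponentials. *)
Definition diag_unit n (M : 'M[A]_n) := 
  exists (V W : 'M[A]_n) (d : 'rV[A]_n), [/\ W *m V = 1%:M,
  forall j, d 0 j \is a GRing.unit & M = V *m diag_mx d *m W].

Lemma diag_unit_conj n (P Q M : 'M[A]_n) : Q *m P = 1%:M ->
  diag_unit M -> diag_unit (P *m M *m Q).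
Proof.
move=> QP [V [W [d [WV dU ->]]]]; exists (P *m V), (W *m Q), d; split=> //.
  by rewrite mulmxA -(mulmxA W) QP mulmx1.
by rewrite !mulmxA.
Qed.

(** Eigenvalues whose difference is a unit make the eigenvectors a basis over
    [A]. *)
Lemma diag_unit_lower p q c : p \is a GRing.unit -> q \is a GRing.unit ->
  p - q \is a GRing.unit -> diag_unit (mx2 p 0 c q).
Proof.
move=> pU qU pqU; set v := c / (p - q).
exists (mx2 1 0 v 1), (mx2 1 0 (- v) 1), (\row_(j < 2) if j == 0 then p else q).
split=> [|j|].
- by rewrite mul_mx2 mx2_1; congr mx2; ring.
- by rewrite mxE; case: ifP.
have cE : c = v * (p - q) by rewrite divrK.
by rewrite diag_mx2 !mul_mx2; congr mx2; rewrite ?cE; ring.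
Qed.

Lemma diag_unit_upper p q c : p \is a GRing.unit -> q \is a GRing.unit ->
  p - q \is a GRing.unit -> diag_unit (mx2 p c 0 q).
Proof.
move=> pU qU pqU; set v := c / (p - q).
exists (mx2 1 (- v) 0 1), (mx2 1 v 0 1), (\row_(j < 2) if j == 0 then p else q).
split=> [|j|].
- by rewrite mul_mx2 mx2_1; congr mx2; ring.
- by rewrite mxE; case: ifP.
have cE : c = v * (p - q) by rewrite divrK.
by rewrite diag_mx2 !mul_mx2; congr mx2; rewrite ?cE; ring.
Qed.

(** The triangular factorization of a matrix with unit corner [a] leaves the
    freedom to multiply the first column of the left factor by [t^-1] and the
    first row of the right factor by [t]; it is used to keep the eigenvalues
    of each factor apart. *)
Lemma mx2_lu t a b c d : t \is a GRing.unit -> a \is a GRing.unit ->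
  a * d - b * c \is a GRing.unit -> t - 1 \is a GRing.unit ->
  1 - t * ((a * d - b * c) * a^-1 ^+ 2) \is a GRing.unit ->
  exists L U, [/\ diag_unit L, diag_unit U & mx2 a b c d = L *m U].
Proof.
set D := a * d - b * c => tU aU DU t1U sepU.
have at1 := divrr aU; have tt1 := divrr tU.
exists (mx2 (a / t) 0 (c / t) (D / a)), (mx2 t (t * b / a) 0 1); split.
- apply: diag_unit_lower; rewrite ?unitrM ?unitrV ?aU ?tU ?DU//.
  suff -> : a / t - D / a = a / t * (1 - t * (D * a^-1 ^+ 2)).
    by rewrite !unitrM sepU aU unitrV tU.
  have -> : a / t * (1 - t * (D * a^-1 ^+ 2)) = a / t - (a / a) * (t / t) * (D / a).
    by ring.
  by rewrite at1 tt1 !mul1r.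
- by apply: diag_unit_upper => //; exact: unitr1.
rewrite mul_mx2 !mul0r !mulr0 !addr0 mulr1 !divrK//; congr mx2.
  have -> : a / t * (t * b / a) = (a / a) * (t / t) * b by ring.
  by rewrite at1 tt1 !mul1r.
have -> : c / t * (t * b / a) + D / a = (t / t) * (b * c / a) - b * c / a + d * (a / a).
  by rewrite /D; ring.
by rewrite at1 tt1 mul1r subrr add0r mulr1.
Qed.

Lemma unimodular_row a b c d : a * d - b * c \is a GRing.unit ->
  a * (d / (a * d - b * c)) + (- c / (a * d - b * c)) * b = 1.
Proof.
set D := a * d - b * c => DU.
have -> : a * (d / D) + (- c / D) * b = D / D by rewrite /D; ring.
by rewrite divrr.
Qed.

(** Conjugation by an elementary matrix replaces the corner [a] by
    [a + x * b]. *)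
Lemma mx2_conj_lu x t a b c d : t \is a GRing.unit -> a + x * b \is a GRing.unit ->
  a * d - b * c \is a GRing.unit -> t - 1 \is a GRing.unit ->
  1 - t * ((a * d - b * c) * (a + x * b)^-1 ^+ 2) \is a GRing.unit ->
  exists L U, [/\ diag_unit L, diag_unit U & mx2 a b c d = L *m U].
Proof.
pose P := mx2 1 0 (- x) 1; pose Q := mx2 1 0 x 1.
have PQ : P *m Q = 1%:M by rewrite mul_mx2 mx2_1; congr mx2; ring.
pose a' := a + x * b; pose c' := c + d * x - x * a'; pose d' := d - x * b.
have conjE : mx2 a b c d = Q *m mx2 a' b c' d' *m P.
  by rewrite !mul_mx2; congr mx2; rewrite /a' /c' /d' /a'; ring.
have -> : a * d - b * c = a' * d' - b * c' by rewrite /a' /c' /d' /a'; ring.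
move=> tU aU DU t1U sep; have [L [U [hL hU LU]]] := mx2_lu tU aU DU t1U sep.
exists (Q *m L *m P), (Q *m U *m P); split; do ?exact: diag_unit_conj.
rewrite conjE LU !mulmxA; congr (_ *m _ *m _).
by rewrite -(mulmxA _ P Q) PQ mulmx1.
Qed.

End Matrices2.

(** * Products of two exponentials *)

Section TwoExponentials.
Variable R : realType.
Local Notation disc_alg := (disc_alg R).

Lemma diag_unit_exp n (M : 'M[disc_alg]_n.+1) : diag_unit M -> exists B, mexp B = M.
Proof.
move=> [V [W [e [WV eU ->]]]].
have log j : {g : disc_alg | forall z, modulus z <= 1 -> cexp (dval g z) = dval (e 0 j) z}.
  exact/cid/disc_alg_log.
exists (V *m diag_mx (\row_j projT1 (log j)) *m W).
by apply: mexp_diag => // j z z1; rewrite mxE; case: (log j) => g /= ->.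
Qed.

(** A small positive constant. *)
Lemma separating_unit (f : disc_alg) : exists t : disc_alg,
  [/\ t \is a GRing.unit, t - 1 \is a GRing.unit & 1 - t * f \is a GRing.unit].
Proof.
have [K K0 hK] := dval_bounded f.
pose c : R := (1 + K)^-1.
have K1 : 0 < 1 + K by rewrite addr_gt0.
have c0 : 0 < c by rewrite invr_gt0.
have c1 : c < 1 by rewrite invf_lt1// ltrDl.
exists (c%:C%C)%:A; split.
- by apply/disc_alg_unitP => z z1; rewrite dvalA// -modulus_gt0 modulusR gtr0_norm.
- rewrite -opprB unitrN; apply: unit_1B => z z1; rewrite dvalA// modulusR.
  by rewrite gtr0_norm.
apply: unit_1B => z z1; rewrite dvalM dvalA// modulusM modulusR gtr0_norm//.
rewrite -(mulVf (lt0r_neq0 K1)) ltr_pM2l// (le_lt_trans (hK z z1))//.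
by rewrite ltrDr.
Qed.

End TwoExponentials.

Theorem corollary2 (R : realType) (A : 'M[disc_alg R]_2) (hA : A \in unitmx) :
  exists B C : 'M[disc_alg R]_2, A = mexp B *m mexp C.
Proof.
move: hA; rewrite unitmxE (mx2_eta A) det_mx2.
move: (A 0 0) (A 0 1) (A 1 0) (A 1 1) => a b c d DU.
have [x xU] := disc_alg_stable_rank (unimodular_row DU).
have [t [tU t1U sep]] := separating_unit ((a * d - b * c) * (a + x * b)^-1 ^+ 2).
have [L [U [/diag_unit_exp[B BL] /diag_unit_exp[E EU] ->]]] := mx2_conj_lu tU xU DU t1U sep.
by exists B, E; rewrite BL EU.
Qed.
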